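(* There is an algorithm that solves the FIFO Stack-Up problem in time $O(n^2\cdot m!)$; in particular, the problem is fixed-parameter tractable with respect to the number $m$ of pallets.
   Context: FIFO Stack-Up problem. An instance consists of a list $Q=(q_1,\ldots,q_k)$ of sequences of pairwise distinct bins, a pallet symbol ${\it plt}(b)$ (a positive integer) for every bin $b$, and a positive integer $p$. Standing assumption: every pallet symbol that occurs is carried by at least two bins. $n$ is the total number of bins and $m$ the number of distinct pallet symbols (pallets). A configuration is a tuple $(i_1,\ldots,i_k)$ with $0\le i_j\le |q_j|$, meaning that the first $i_j$ bins of $q_j$ have been removed. A pallet $t$ is open in configuration $(i_1,\ldots,i_k)$ if there are indices $j,\ell$ such that some bin for $t$ is at a position $\le i_j$ in $q_j$ and some bin for $t$ is at a position $> i_\ell$ in $q_\ell$. A transformation step removes the bin at position $i_j+1$ of some sequence $q_j$ (with $i_j<|q_j|$). A processing of $Q$ is a sequence of transformation steps from $(0,\ldots,0)$ to $(|q_1|,\ldots,|q_k|)$. The question is whether there is a processing of $Q$ such that in each configuration during the processing at most $p$ pallets are open. *)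

(* Defs.v *)
From mathcomp Require Import all_boot.

Set Implicit Arguments.
Unset Strict Implicit.
Unset Printing Implicit Defensive.

(** * Random access machines under the uniform cost criterion *)

(* The model is the random access machine with addition and (truncated)
   subtraction but no multiplication, so that uniform-cost time is polynomially
   related to Turing machine time.  Control flow is structured instead of being
   given by jumps; this changes running times by a constant factor only.
   A program mentions finitely many registers, and the memory is reached by
   indirect addressing. *)

Inductive test :=
  | TLt of nat & nat
  | TEq of nat & nat.

Inductive prog :=
  | PSkip
  | PConst of nat & nat
  | PMove of nat & nat
  | PAdd of nat & nat & nat
  | PSub of nat & nat & nat
  | PLoad of nat & nat
  | PStore of nat & nat
  | PSeq of prog & prog
  | PIf of test & prog & prog
  | PWhile of test & prog.

Record state := State { reg : nat -> nat; cell : nat -> nat }.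

Definition set_reg (s : state) (x v : nat) : state :=
  State [eta reg s with x |-> v] (cell s).

Definition set_mem (s : state) (a v : nat) : state :=
  State (reg s) [eta cell s with a |-> v].

Definition eval_test (b : test) (s : state) : bool :=
  match b with
  | TLt x y => reg s x < reg s y
  | TEq x y => reg s x == reg s y
  end.

(* [exec c s t s']: started in [s], the program [c] halts in [s'] after exactly
   [t] elementary operations (assignments, memory accesses and tests). *)
Inductive exec : prog -> state -> nat -> state -> Prop :=
  | ESkip s : exec PSkip s 1 s
  | EConst x v s : exec (PConst x v) s 1 (set_reg s x v)
  | EMove x y s : exec (PMove x y) s 1 (set_reg s x (reg s y))
  | EAdd x y z s : exec (PAdd x y z) s 1 (set_reg s x (reg s y + reg s z))
  | ESub x y z s : exec (PSub x y z) s 1 (set_reg s x (reg s y - reg s z))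
  | ELoad x y s : exec (PLoad x y) s 1 (set_reg s x (cell s (reg s y)))
  | EStore x y s : exec (PStore x y) s 1 (set_mem s (reg s x) (reg s y))
  | ESeq c1 c2 s s1 s2 t1 t2 :
      exec c1 s t1 s1 -> exec c2 s1 t2 s2 ->
      exec (PSeq c1 c2) s (t1 + t2) s2
  | EIfTrue b c1 c2 s s1 t :
      eval_test b s -> exec c1 s t s1 -> exec (PIf b c1 c2) s t.+1 s1
  | EIfFalse b c1 c2 s s1 t :
      ~~ eval_test b s -> exec c2 s t s1 -> exec (PIf b c1 c2) s t.+1 s1
  | EWhileTrue b c s s1 s2 t1 t2 :
      eval_test b s -> exec c s t1 s1 -> exec (PWhile b c) s1 t2 s2 ->
      exec (PWhile b c) s (t1 + t2).+1 s2
  | EWhileFalse b c s :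
      ~~ eval_test b s -> exec (PWhile b c) s 1 s.

(* The input words occupy the first memory cells and register 0 holds their
   number; everything else is 0. *)
Definition init_state (w : seq nat) : state :=
  State [eta (fun=> 0) with 0 |-> size w] (nth 0 w).

Definition output (s : state) : nat := reg s 0.

(** * Decision problems *)

(* A decision problem has instances in [I], written as lists of words by [enc];
   [P] holds of the yes-instances. *)

Definition decides_within (I : Type) (enc : I -> seq nat) (P : I -> Prop)
    (c : prog) (T : I -> nat) : Prop :=
  forall x : I, exists (t : nat) (s : state) (b : bool),
    [/\ exec c (init_state (enc x)) t s, t <= T x,
        output s = b & b <-> P x].

(* Running time O(g).  The successor matters only where [g] vanishes (on the
   instance without bins): no program halts after 0 operations. *)
Definition solvable_in_time_O (I : Type) (enc : I -> seq nat) (P : I -> Prop)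
    (g : I -> nat) : Prop :=
  exists (c : prog) (C : nat), decides_within enc P c (fun x => C * (g x).+1).

Definition computable (f : nat -> nat) : Prop :=
  exists c : prog, forall k : nat, exists (t : nat) (s : state),
    exec c (init_state [:: k]) t s /\ output s = f k.

Definition bit_size (w : seq nat) : nat :=
  \sum_(a <- w) (trunc_log 2 a).+1.

Definition fixed_parameter_tractable (I : Type) (enc : I -> seq nat)
    (P : I -> Prop) (kappa : I -> nat) : Prop :=
  exists (c : prog) (f : nat -> nat) (d : nat),
    computable f /\
    decides_within enc P c (fun x => f (kappa x) * bit_size (enc x) ^ d).

(** * The FIFO Stack-Up problem *)

Record instance := Instance {
  bin : eqType;
  queues : seq (seq bin);
  plt : bin -> nat;
  places : nat;
  uniq_bins : uniq (flatten queues);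
  plt_gt0 : forall b, b \in flatten queues -> 0 < plt b;
  plt_twice : forall b, b \in flatten queues ->
    1 < count (fun b' => plt b' == plt b) (flatten queues);
  places_gt0 : 0 < places
}.

Definition bins (x : instance) : seq (bin x) := flatten (queues x).

Definition pallets (x : instance) : seq nat := undup (map (@plt x) (bins x)).

Definition n_bins (x : instance) : nat := size (bins x).

Definition n_pallets (x : instance) : nat := size (pallets x).

Definition n_queues (x : instance) : nat := size (queues x).

Definition queue (x : instance) (j : nat) : seq (bin x) := nth [::] (queues x) j.

(* A configuration (i_1, ..., i_k) is the list of the i_j, indexed from 0. *)
Definition config := seq nat.

Definition start (x : instance) : config := nseq (n_queues x) 0.

Definition finish (x : instance) : config := map size (queues x).

Definition removed (x : instance) (i : config) (j : nat) : seq (bin x) :=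
  take (nth 0 i j) (queue x j).

Definition remaining (x : instance) (i : config) (j : nat) : seq (bin x) :=
  drop (nth 0 i j) (queue x j).

Definition is_open (x : instance) (i : config) (t : nat) : bool :=
  [exists j : 'I_(n_queues x), exists l : 'I_(n_queues x),
    has (fun b => plt b == t) (removed x i j) &&
    has (fun b => plt b == t) (remaining x i l)].

Definition n_open (x : instance) (i : config) : nat :=
  count (is_open x i) (pallets x).

Definition step (x : instance) (i i' : config) : bool :=
  [exists j : 'I_(n_queues x),
    (nth 0 i j < size (queue x j)) && (i' == incr_nth i j)].

(* [s] lists the configurations reached after the initial one. *)
Definition processing (x : instance) (s : seq config) : bool :=
  path (step x) (start x) s && (last (start x) s == finish x).

Definition stack_up (x : instance) : Prop :=
  exists s : seq config,
    processing x s /\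
    (forall i, i \in start x :: s -> n_open x i <= places x).

(* The input consists of k, p, n followed, sequence by sequence and in order, by
   one pair (index of the sequence, pallet symbol) per bin.  It has 3 + 2n words
   however many of the k sequences are empty. *)
Definition encode (x : instance) : seq nat :=
  [:: n_queues x; places x; n_bins x] ++
  flatten [seq flatten [seq [:: j; plt b] | b <- queue x j]
          | j <- iota 0 (n_queues x)].

(* Main.v *)
(* For a set S of pallets let c(S) be the furthest configuration reached by
   removing only bins for pallets in S.  If the pallets are opened in the order
   t_1, ..., t_m, then before t_(i+1) is opened nothing is lost by moving on to
   c({t_1, ..., t_i}), since removing bins of pallets already opened can only
   close pallets.  Hence a processing exists iff the pallets have an order such
   that, for every initial segment S of it, fewer than p pallets of S have bins
   left in c(S).  These orders are searched by dynamic programming over the 2^m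
   sets S, encoded as bit masks; each set takes a single pass over the bins, and
   2^m <= 2 m!. *)

Require Import Defs.
From mathcomp Require Import all_boot zify.

Set Implicit Arguments.
Unset Strict Implicit.
Unset Printing Implicit Defensive.

(** The bound [< p] is strict because the pallet opened next comes on top of those stuck at c(S). In
    one direction, between c(S) and c(S + t) only t and the stuck pallets can be open. In the other,
    an arbitrary processing stands somewhere below c(S) just before it opens t, so whatever is stuck
    at c(S) is open already, and t becomes open as well because a second bin for t remains; this is
    what the standing assumption provides. The program never computes c(S): a pallet of S is stuck
    iff one of its bins follows, in the same queue, a bin for a pallet outside S, which a
    left-to-right pass can detect. Two limits of the machine shape the rest. Pallet symbols are
    arbitrary integers and cannot serve as offsets into memory, so they are first replaced by
    numbers below m through linear search, at a cost of O(n m). There is neither division nor shift,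
    so a table of powers of 2 serves to read the bits of a mask and to remove one of them. *)

(** * Total correctness with time bounds *)

(** An upper bound instead of the exact time lets branches of different lengths share one
    specification. *)
Definition runs (c : prog) (s : state) (T : nat) (Q : state -> Prop) : Prop :=
  exists t s', [/\ exec c s t s', t <= T & Q s'].

Fixpoint written (c : prog) : seq nat :=
  match c with
  | PConst x _ | PMove x _ | PAdd x _ _ | PSub x _ _ | PLoad x _ => [:: x]
  | PSkip | PStore _ _ => [::]
  | PSeq c1 c2 | PIf _ c1 c2 => written c1 ++ written c2
  | PWhile _ c => written c
  end.

Lemma exec_frame c s t s' r :
  exec c s t s' -> r \notin written c -> reg s' r = reg s r.
Proof.
elim=> //= {c s t s'}.
1-5: by move=> *; rewrite ifN //; match goal with H : is_true (_ \notin _) |- _ => move: H; rewrite inE end.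
- by move=> c1 c2 s s1 s2 t1 t2 _ IH1 _ IH2; rewrite mem_cat negb_or => /andP[/IH1 <- /IH2].
- by move=> b c1 c2 s s1 t _ _ IH; rewrite mem_cat negb_or => /andP[/IH].
- by move=> b c1 c2 s s1 t _ _ IH; rewrite mem_cat negb_or => /andP[_ /IH].
- by move=> b c s s1 s2 t1 t2 _ _ IH1 _ IH2 Hr; rewrite IH2 // IH1.
Qed.

Lemma runs_frame c s T Q :
  runs c s T Q ->
  runs c s T
    (fun s' => Q s' /\ forall r, r \notin written c -> reg s' r = reg s r).
Proof.
move=> [t [s' [E Ht HQ]]]; exists t, s'; split=> //; split=> // r.
exact: exec_frame E.
Qed.

Lemma runs_weaken c s T T' (Q Q' : state -> Prop) :
  runs c s T Q -> T <= T' -> (forall s', Q s' -> Q' s') -> runs c s T' Q'.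
Proof.
move=> [t [s' [E Ht HQ]]] HT HQQ; exists t, s'; split=> //; last exact: HQQ.
exact: leq_trans HT.
Qed.

Lemma runs_seq c1 c2 s T1 T2 Q :
  runs c1 s T1 (fun s1 => runs c2 s1 T2 Q) -> runs (PSeq c1 c2) s (T1 + T2) Q.
Proof.
move=> [t1 [s1 [E1 Ht1 [t2 [s2 [E2 Ht2 HQ]]]]]].
by exists (t1 + t2), s2; split=> //; [apply: ESeq E1 E2 | apply: leq_add].
Qed.

Lemma runs_skip s T (Q : state -> Prop) : Q s -> runs PSkip s T.+1 Q.
Proof. by move=> HQ; exists 1, s; split=> //; apply: ESkip. Qed.

Lemma runs_const x v s T (Q : state -> Prop) :
  Q (set_reg s x v) -> runs (PConst x v) s T.+1 Q.
Proof. by move=> HQ; exists 1, (set_reg s x v); split=> //; apply: EConst. Qed.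

Lemma runs_move x y s T (Q : state -> Prop) :
  Q (set_reg s x (reg s y)) -> runs (PMove x y) s T.+1 Q.
Proof. by move=> HQ; eexists 1, _; split=> //; [apply: EMove|]. Qed.

Lemma runs_add x y z s T (Q : state -> Prop) :
  Q (set_reg s x (reg s y + reg s z)) -> runs (PAdd x y z) s T.+1 Q.
Proof. by move=> HQ; eexists 1, _; split=> //; [apply: EAdd|]. Qed.

Lemma runs_sub x y z s T (Q : state -> Prop) :
  Q (set_reg s x (reg s y - reg s z)) -> runs (PSub x y z) s T.+1 Q.
Proof. by move=> HQ; eexists 1, _; split=> //; [apply: ESub|]. Qed.

Lemma runs_load x y s T (Q : state -> Prop) :
  Q (set_reg s x (cell s (reg s y))) -> runs (PLoad x y) s T.+1 Q.
Proof. by move=> HQ; eexists 1, _; split=> //; [apply: ELoad|]. Qed.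

Lemma runs_store x y s T (Q : state -> Prop) :
  Q (set_mem s (reg s x) (reg s y)) -> runs (PStore x y) s T.+1 Q.
Proof. by move=> HQ; eexists 1, _; split=> //; [apply: EStore|]. Qed.

Lemma runs_if b c1 c2 s T Q :
  (eval_test b s -> runs c1 s T Q) -> (~~ eval_test b s -> runs c2 s T Q) ->
  runs (PIf b c1 c2) s T.+1 Q.
Proof.
move=> H1 H2; case Hb: (eval_test b s).
  by have [t [s1 [E Ht HQ]]] := H1 Hb; exists t.+1, s1; split=> //; apply: EIfTrue.
have {}Hb: ~~ eval_test b s by rewrite Hb.
by have [t [s1 [E Ht HQ]]] := H2 Hb; exists t.+1, s1; split=> //; apply: EIfFalse.
Qed.

Definition agrees_off (xs : seq nat) (s s' : state) : Prop :=
  forall r, r \notin xs -> reg s' r = reg s r.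

(** The invariant is indexed by the number of rounds done. [T.+1] charges the test of each round,
    the outer successor the final failing test. The frame [agrees_off] is supplied to both premises,
    so [I] need only speak of what the body changes. *)
Lemma runs_while b c s n T (I : nat -> state -> Prop) :
  I 0 s ->
  (forall i s', i <= n -> I i s' -> agrees_off (written c) s s' ->
    eval_test b s' = (i < n)) ->
  (forall i s', i < n -> I i s' -> agrees_off (written c) s s' ->
    runs c s' T (I i.+1)) ->
  runs (PWhile b c) s (n * T.+1).+1 (I n).
Proof.
move=> I0 Hb Hc.
suff H k s' : k <= n -> I (n - k) s' -> agrees_off (written c) s s' ->
    runs (PWhile b c) s' (k * T.+1).+1 (I n).
  by apply: H; rewrite ?subnn.
elim: k s' => [|k IH] s' Hk Ik As'.
  exists 1, s'; split=> //; last by rewrite subn0 in Ik.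
  by apply: EWhileFalse; rewrite (Hb _ _ _ Ik) ?subn0 ?ltnn.
have Hlt: n - k.+1 < n by lia.
have [t1 [s1 [E1 Ht1 [I1 A1]]]] := runs_frame (Hc _ _ Hlt Ik As').
have Hs : (n - k.+1).+1 = n - k by lia.
rewrite Hs in I1.
have As1 : agrees_off (written c) s s1 by move=> r Hr; rewrite A1 // As'.
have [t2 [s2 [E2 Ht2 HQ]]] := IH s1 (ltnW Hk) I1 As1.
exists (t1 + t2).+1, s2; split=> //; last by lia.
by apply: EWhileTrue E1 E2; rewrite (Hb _ _ _ Ik) ?leq_subr.
Qed.

Lemma runs_seqS c1 c2 s T Q :
  runs c1 s 1 (fun s1 => runs c2 s1 T Q) -> runs (PSeq c1 c2) s T.+1 Q.
Proof. exact: runs_seq. Qed.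

Lemma runs_seqA c1 c2 c3 s T Q :
  runs (PSeq c1 (PSeq c2 c3)) s T Q -> runs (PSeq (PSeq c1 c2) c3) s T Q.
Proof.
move=> [t [s' [E Ht HQ]]]; exists t, s'; split=> //.
inversion_clear E as [| | | | | | |? ? ? s1 ? t1 t2 E1 E23| | | |].
inversion_clear E23 as [| | | | | | |? ? ? s2 ? t3 t4 E2 E3| | | |].
by rewrite addnA; apply: ESeq E3; apply: ESeq E1 E2.
Qed.

(** The continuation is copied into both branches, which spares a common postcondition at the point
    where they join. *)
Lemma runs_seq_if b c1 c2 c s T Q :
  (eval_test b s -> runs (PSeq c1 c) s T Q) ->
  (~~ eval_test b s -> runs (PSeq c2 c) s T Q) ->
  runs (PSeq (PIf b c1 c2) c) s T.+1 Q.
Proof.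
move=> H1 H2; case Hb: (eval_test b s).
  have [t [s' [E Ht HQ]]] := H1 Hb; exists t.+1, s'; split=> //.
  inversion_clear E as [| | | | | | |? ? ? s1 ? t1 t2 E1 E2| | | |].
  by rewrite -addSn; apply: ESeq E2; apply: EIfTrue.
have {}Hb: ~~ eval_test b s by rewrite Hb.
have [t [s' [E Ht HQ]]] := H2 Hb; exists t.+1, s'; split=> //.
inversion_clear E as [| | | | | | |? ? ? s1 ? t1 t2 E1 E2| | | |].
by rewrite -addSn; apply: ESeq E2; apply: EIfFalse.
Qed.

Lemma runs_call T1 T2 Q1 c1 c2 s T Q :
  runs c1 s T1 Q1 -> T1 + T2 <= T ->
  (forall s', Q1 s' -> agrees_off (written c1) s s' -> runs c2 s' T2 Q) ->
  runs (PSeq c1 c2) s T Q.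
Proof.
move=> H HT Hc; apply: (runs_weaken _ HT (fun _ => id)); apply: runs_seq.
by apply: runs_weaken (runs_frame H) (leqnn _) _ => s' [H1 /Hc]; apply.
Qed.

Lemma runs_tail T1 Q1 c s T Q :
  runs c s T1 Q1 -> T1 <= T ->
  (forall s', Q1 s' -> agrees_off (written c) s s' -> Q s') ->
  runs c s T Q.
Proof.
by move=> H HT HQ; apply: runs_weaken (runs_frame H) HT _ => s' [H1 /HQ]; apply.
Qed.

Ltac step :=
  lazymatch goal with
  | |- runs (PSeq (PSeq _ _) _) _ _ _ => apply: runs_seqA
  | |- runs (PSeq (PIf _ _ _) _) _ _ _ => apply: runs_seq_if => /=
  | |- runs (PSeq _ _) _ _ _ => apply: runs_seqS
  | |- runs (PIf _ _ _) _ _ _ => apply: runs_if => /=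
  | |- runs PSkip _ _ _ => apply: runs_skip => /=
  | |- runs (PConst _ _) _ _ _ => apply: runs_const => /=
  | |- runs (PMove _ _) _ _ _ => apply: runs_move => /=
  | |- runs (PAdd _ _ _) _ _ _ => apply: runs_add => /=
  | |- runs (PSub _ _ _) _ _ _ => apply: runs_sub => /=
  | |- runs (PLoad _ _) _ _ _ => apply: runs_load => /=
  | |- runs (PStore _ _) _ _ _ => apply: runs_store => /=
  end.

Notation "c1 ;; c2" := (PSeq c1 c2) (at level 60, right associativity).

(** * Bins and blocked pallets *)

Definition labels (x : instance) (j : nat) : seq nat := map (@plt x) (queue x j).

Definition items (x : instance) : seq (nat * nat) :=
  flatten [seq [seq (j, t) | t <- labels x j] | j <- iota 0 (n_queues x)].

(* Items are pairs (queue, pallet).  For t in S, [behind S l t] says that a bin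
   for t comes after a bin for a pallet outside S in the same queue, i.e. that it
   is still there when only pallets in S have been removed. *)
Definition behind (S : pred nat) (l : seq (nat * nat)) (t : nat) : bool :=
  has (fun y => ~~ S y.2 && mem2 l y (y.1, t)) l.

Definition stuck (S : pred nat) (l : seq (nat * nat)) (sym : seq nat) : nat :=
  count (fun t => S t && behind S l t) sym.

(* The head of s is the pallet opened last. *)
Fixpoint good (p : nat) (l : seq (nat * nat)) (sym s : seq nat) : bool :=
  (stuck (mem s) l sym < p) && (if s is _ :: s' then good p l sym s' else true).

Lemma eq_stuck S S' l sym : S =1 S' -> stuck S l sym = stuck S' l sym.
Proof.
move=> eS; apply: eq_count => t; rewrite /= eS; congr (_ && _).
by apply: eq_has => y; rewrite eS.
Qed.

Lemma mem2_filter (T : eqType) (a : pred T) s x y :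
  a x -> a y -> mem2 (filter a s) x y = mem2 s x y.
Proof.
by move=> ax ay; rewrite !mem2E; case: eqP => _; rewrite subseq_filter /= ?ax ?ay.
Qed.

Lemma mem_drop_leq (T : eqType) (s : seq T) i j t :
  i <= j -> t \in drop j s -> t \in drop i s.
Proof. by move=> /subnK <-; rewrite -drop_drop; apply: mem_drop. Qed.

(** [mem2 s u t] looks from the first occurrence of [u] onwards, so among all [u] satisfying [a] the
    earliest one leaves the longest suffix, which starts at [find a s]. *)
Lemma mem_drop_find (T : eqType) (a : pred T) s t :
  (t \in drop (find a s) s) = has (fun u => a u && mem2 s u t) s.
Proof.
apply/idP/hasP => [Ht|[u us /andP[au]]].
  have Ha : find a s < size s.
    by rewrite ltnNge; apply/negP => /drop_oversize e; rewrite e in Ht.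
  exists (nth t s (find a s)); first exact: mem_nth.
  rewrite nth_find ?has_find //=; apply: mem_drop_leq Ht.
  rewrite -ltnS; apply: find_ltn; rewrite (take_nth t) // has_rcons /=.
  by rewrite eqxx.
apply: mem_drop_leq; rewrite leqNgt; apply/negP => /(before_find u).
by rewrite nth_index // au.
Qed.

(** * The bins as one list sorted by queue *)

Lemma items_filter x j :
  [seq y <- items x | y.1 == j] = [seq (j, t) | t <- labels x j].
Proof.
have H k (w : nat -> seq nat) a : [seq y <- flatten [seq [seq (i, t) | t <- w i] | i <- iota a k] | y.1 == j]
   = if a <= j < a + k then [seq (j, t) | t <- w j] else [::].
  elim: k a => [|k IH] a /=; first by case: ifP => //; lia.
  rewrite filter_cat IH filter_map /=.
  rewrite (eq_filter (a2 := fun=> a == j)) //.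
  case: eqVneq => [<-|ne].
    by rewrite filter_predT ltnn /= cats0 leqnn -addSnnS leq_addr.
  rewrite filter_pred0 /=.
  by have -> : (a < j < a.+1 + k) = (a <= j < a + k.+1) by lia.
rewrite H; case: ifP => // Hj.
by rewrite /labels /queue nth_default //; rewrite /n_queues in Hj *; lia.
Qed.

Lemma mem2_items x j u t :
  mem2 (items x) (j, u) (j, t) = mem2 (labels x j) u t.
Proof.
rewrite -(mem2_filter (a := fun y => y.1 == j)) //= items_filter.
by rewrite (mem2_map (h := pair j)) // => ? ? [].
Qed.

Lemma items_labels x : map snd (items x) = map (@plt x) (bins x).
Proof.
rewrite /items /bins -[in RHS](mkseq_nth [::] (queues x)) /mkseq.
rewrite !map_flatten -!map_comp; congr flatten; apply: eq_map => j /=.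
by rewrite -map_comp map_id.
Qed.

Lemma items_sorted x : pairwise (fun y z : nat * nat => y.1 <= z.1) (items x).
Proof.
rewrite /items; elim: (n_queues x) 0 => //= k IH a.
rewrite pairwise_cat IH andbT pairwise_map; apply/andP; split.
  apply/allrelP => y z /mapP[t _ ->] /flattenP[s /mapP[i]].
  by rewrite mem_iota => /andP[Hi _] -> /mapP[? _ ->] /=; lia.
by apply/(pairwiseP 0) => i j; rewrite /= leqnn.
Qed.

Lemma encode_items x :
  encode x = [:: n_queues x, places x, n_bins x & flatten [seq [:: y.1; y.2] | y <- items x]].
Proof.
rewrite /encode /=; do 3!congr cons.
rewrite /items; elim: (iota _ _) => //= j s ->.
by rewrite map_cat flatten_cat /labels -!map_comp.
Qed.

Lemma size_items x : size (items x) = n_bins x.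
Proof. by rewrite -(size_map snd) items_labels size_map. Qed.

(** Translates the order within the list read by the machine into configurations:
    [find (predC S) (labels x j)] is how far queue [j] can be emptied when only pallets in [S] are
    touched. *)
Lemma behindP S x t :
  reflect (exists2 j, j < n_queues x & t \in drop (find (predC S) (labels x j)) (labels x j))
    (behind S (items x) t).
Proof.
apply: (iffP hasP) => [[[j u] Hy /= /andP[Su M]]|[j Hj]].
  rewrite mem2_items in M; exists j.
    rewrite ltnNge; apply/negP => Hj.
    by move: M; rewrite /labels /queue nth_default.
  by rewrite mem_drop_find; apply/hasP; exists u; rewrite ?(mem2l M) //= Su.
rewrite mem_drop_find => /hasP[u Hu /andP[/= Su M]].
rewrite -mem2_items in M; exists (j, u); rewrite ?(mem2l M) //= Su //.
Qed.

Lemma has_label (x : instance) t (s : seq (bin x)) :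
  has (fun b => plt b == t) s = (t \in map (@plt x) s).
Proof. by rewrite -has_pred1 has_map. Qed.

Lemma is_openP x i t :
  reflect (exists j l, [/\ j < n_queues x, l < n_queues x,
      t \in take (nth 0 i j) (labels x j) & t \in drop (nth 0 i l) (labels x l)])
    (is_open x i t).
Proof.
apply: (iffP idP) => [/existsP[j /existsP[l /andP[Hj Hl]]]|[j [l [jk lk Hj Hl]]]].
  exists j, l; rewrite !ltn_ord; move: Hj Hl.
  by rewrite /removed /remaining !has_label map_take map_drop.
apply/existsP; exists (Ordinal jk); apply/existsP; exists (Ordinal lk).
by rewrite /removed /remaining !has_label map_take map_drop Hj.
Qed.

Lemma mem_pallets x t :
  (t \in pallets x) = has (fun j => t \in labels x j) (iota 0 (n_queues x)).
Proof.
rewrite mem_undup -items_labels /items map_flatten -map_comp.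
apply/flattenP/hasP => [[s /mapP[j Hj ->]]|[j Hj Ht]].
  by rewrite /= -map_comp map_id => Ht; exists j.
by exists (labels x j) => //; apply/mapP; exists j; rewrite //= -map_comp map_id.
Qed.

Lemma mem_pallets_label x j t :
  j < n_queues x -> t \in labels x j -> t \in pallets x.
Proof. by move=> Hj Ht; rewrite mem_pallets; apply/hasP; exists j; rewrite ?mem_iota. Qed.

(** * From an order of the pallets to a processing *)

Lemma path_between x (i i' : config) :
  size i = n_queues x -> size i' = n_queues x ->
  (forall j, nth 0 i j <= nth 0 i' j) ->
  (forall j, nth 0 i' j <= size (queue x j)) ->
  exists s, [/\ path (step x) i s, last i s = i' &
    forall c, c \in s -> forall j, nth 0 i j <= nth 0 c j <= nth 0 i' j].
Proof.
move En: (\sum_(j < n_queues x) (nth 0 i' j - nth 0 i j)) => n.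
elim: n i En => [|n IH] i En si si' le le'.
  exists [::]; split=> //=; apply: (@eq_from_nth _ 0); first by rewrite si si'.
  move=> j; rewrite si => jk; apply/eqP; rewrite eqn_leq le -subn_eq0 /=.
  by move/eqP: En; rewrite sum_nat_eq0 => /forallP/(_ (Ordinal jk)).
have [j Hj] : exists j : 'I_(n_queues x), 0 < nth 0 i' j - nth 0 i j.
  apply/existsP; rewrite -[X in is_true X]negbK negb_exists; apply/negP => /forallP H.
  by move: En; rewrite big1 // => j _; apply/eqP; move: (H j) => /=; lia.
have ltj: nth 0 i j < nth 0 i' j by lia.
have [s [ps ls Hs]] : exists s, [/\ path (step x) (incr_nth i j) s, last (incr_nth i j) s = i' &
    forall c, c \in s -> forall j', nth 0 (incr_nth i j) j' <= nth 0 c j' <= nth 0 i' j'].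
  apply: IH => //.
  - rewrite (bigD1 j) //= nth_incr_nth eqxx.
    rewrite (eq_bigr (fun j' : 'I__ => nth 0 i' j' - nth 0 i j')) => [|j' nj].
      move: En; rewrite (bigD1 j) //=.
      by move: (\sum_(_ < _ | _) _) => m /=; lia.
    rewrite nth_incr_nth; case: eqP => [/val_inj e|] //.
    by rewrite e eqxx in nj.
  - by rewrite size_incr_nth si ltn_ord.
  - by move=> j'; rewrite nth_incr_nth; case: eqP => [<-|] //=; rewrite add0n.
exists (incr_nth i j :: s); split=> //=.
  rewrite ps andbT; apply/existsP; exists j; rewrite eqxx andbT.
  exact: leq_trans ltj _.
move=> c; rewrite inE => /orP[/eqP->|/Hs Hc] j'.
  rewrite nth_incr_nth; case: eqP => [<-|] /=; first lia.
  by have := le j'; lia.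
by have := Hc j'; rewrite nth_incr_nth; lia.
Qed.

Definition furthest (x : instance) (S : pred nat) : config :=
  [seq find (predC S) (map (@plt x) q) | q <- queues x].

Lemma size_furthest x S : size (furthest x S) = n_queues x.
Proof. by rewrite size_map. Qed.

Lemma nth_furthest x S j : nth 0 (furthest x S) j = find (predC S) (labels x j).
Proof.
rewrite /labels /queue; case: (ltnP j (n_queues x)) => Hj.
  by rewrite (nth_map [::]).
by rewrite !nth_default // size_map.
Qed.

Lemma take_find_sub (T : eqType) (a : pred T) s n t :
  n <= find a s -> t \in take n s -> ~~ a t.
Proof.
move=> Hn /(nthP t)[i Hi <-]; rewrite size_take_min in Hi.
by rewrite nth_take ?(before_find t) //; lia.
Qed.

Lemma stuck_nil l sym : stuck (mem [::]) l sym = 0.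
Proof. exact: count_pred0. Qed.

(** A pallet open in [i] has been begun below [furthest x S'], so it is [t] or lies in [S]; in the
    latter case its remaining bin also remains in the earlier configuration [furthest x S], so it is
    stuck there. *)
Lemma n_open_between x (S S' : pred nat) t i :
  {subset S' <= predU1 t S} ->
  (forall j, nth 0 (furthest x S) j <= nth 0 i j <= nth 0 (furthest x S') j) ->
  n_open x i <= (stuck S (items x) (pallets x)).+1.
Proof.
move=> sub Hi; rewrite /n_open /stuck.
apply: (@leq_trans (count (predU (pred1 t) (fun u => S u && behind S (items x) u)) (pallets x))).
  apply: sub_count => u /is_openP[j [l [jk lk uj ul]]] /=.
  have /andP[_ ij] := Hi j; have /andP[il _] := Hi l; rewrite !nth_furthest in ij il.
  have /sub := negPn (take_find_sub ij uj).
  rewrite !inE => /orP[->//|Su]; apply/orP; right; rewrite [S u]Su.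
  by apply/behindP; exists l => //; apply: mem_drop_leq ul.
have := count_predUI (pred1 t) (fun u => S u && behind S (items x) u) (pallets x).
have := count_uniq_mem t (undup_uniq (map (@plt x) (bins x))).
by rewrite -/(pallets x); case: (t \in _) => /=; lia.
Qed.

Lemma good_stuck p l sym s : good p l sym s -> stuck (mem s) l sym < p.
Proof. by case: s => [|t s] /andP[]. Qed.

(** The processing runs through the furthest configurations of the tails of [s], joined by monotone
    paths; the path that opens the head is controlled by the stuck pallets of the tail. *)
Lemma good_processing x s :
  uniq s -> {subset s <= pallets x} ->
  good (places x) (items x) (pallets x) s ->
  exists cs, [/\ path (step x) (start x) cs, last (start x) cs = furthest x (mem s) &
    forall c, c \in start x :: cs -> n_open x c <= places x].
Proof.
elim: s => [|t s IH] /=.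
  move=> _ _ _; exists [::]; split=> //=.
    apply: (@eq_from_nth _ 0) => [|j]; rewrite size_nseq ?size_furthest // => Hj.
    by rewrite nth_furthest nth_nseq Hj; case: (labels x j).
  move=> c; rewrite inE => /eqP->; rewrite /n_open (eq_count (a2 := pred0)) ?count_pred0 //.
  move=> t /=; apply/is_openP => -[j [l [jk _]]].
  by rewrite nth_nseq jk take0.
move=> /andP[ts us] sub /andP[_ gs].
have [cs [pcs lcs Hcs]] := IH us (fun u us => sub u (mem_behead (s := t :: s) us)) gs.
have [||j|j|ds [pds lds Hds]] := @path_between x (furthest x (mem s)) (furthest x (mem (t :: s))).
- exact: size_furthest.
- exact: size_furthest.
- rewrite !nth_furthest; apply: sub_find => u /=.
  by rewrite inE negb_or => /andP[].
- by rewrite nth_furthest (leq_trans (find_size _ _)) // size_map.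
exists (cs ++ ds); rewrite cat_path last_cat lcs; split=> //; first exact/andP.
move=> c; rewrite -cat_cons mem_cat => /orP[/Hcs//|/Hds Hc].
apply: leq_trans (n_open_between (S := mem s) (S' := mem (t :: s)) (t := t) _ Hc) _ => //.
exact: good_stuck gs.
Qed.

Lemma furthest_full x (S : pred nat) :
  {subset pallets x <= S} -> furthest x S = finish x.
Proof.
move=> sub; apply/eq_in_map => q /(nthP [::])[j Hj <-].
rewrite hasNfind ?size_map //; apply/hasPn => t Ht /=.
by rewrite negbK; apply: sub; apply: mem_pallets_label Ht.
Qed.

Lemma stuck_full x (S : pred nat) sym :
  {subset pallets x <= S} -> stuck S (items x) sym = 0.
Proof.
move=> sub; rewrite /stuck (eq_count (a2 := pred0)) ?count_pred0 // => t /=.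
apply/negP => /andP[_ /hasP[[j u] Hu /= /andP[/negP[]]]]; apply/sub.
by rewrite mem_undup -items_labels; apply/mapP; exists (j, u).
Qed.

(** * From a processing to an order of the pallets *)

Definition begun (x : instance) (i : config) (t : nat) : bool :=
  has (fun j => t \in take (nth 0 i j) (labels x j)) (iota 0 (n_queues x)).

Lemma begunP x i t :
  reflect (exists2 j, j < n_queues x & t \in take (nth 0 i j) (labels x j)) (begun x i t).
Proof.
apply: (iffP hasP) => -[j Hj Ht]; exists j => //.
  by rewrite mem_iota in Hj.
by rewrite mem_iota.
Qed.

(** The standing assumption enters here: were [b] the only bin with its symbol, distinctness of the
    bins would make the count 1. *)
Lemma another_bin x (b : bin x) : b \in bins x ->
  exists2 b', b' \in bins x & plt b' = plt b /\ b' != b.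
Proof.
move=> Hb; have := plt_twice Hb; rewrite -/(bins x).
case Hh: (has (fun b' => (plt b' == plt b) && (b' != b)) (bins x)).
  by move/hasP: Hh => [b' Hb' /andP[/eqP e ne]] _; exists b'.
move/negbT/hasPn: Hh => Hh.
rewrite (eq_in_count (a2 := pred1 b)) => [|b' /Hh].
  by rewrite (count_uniq_mem _ (uniq_bins x)) (_ : b \in _ = true).
by rewrite negb_and negbK /=; case: (eqVneq b' b) => [->|_]; rewrite ?eqxx ?orbF // => /negbTE.
Qed.

Lemma begun_incr x i j b0 t :
  j < n_queues x -> nth 0 i j < size (queue x j) ->
  begun x (incr_nth i j) t = begun x i t || (t == plt (nth b0 (queue x j) (nth 0 i j))).
Proof.
move=> jk Hj.
have take_incr : take (nth 0 (incr_nth i j) j) (labels x j)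
    = rcons (take (nth 0 i j) (labels x j)) (plt (nth b0 (queue x j) (nth 0 i j))).
  by rewrite nth_incr_nth eqxx add1n (take_nth 0) ?size_map // (nth_map b0).
apply/begunP/orP => [[l lk]|[/begunP[l lk Ht]|/eqP->]].
- case: (eqVneq j l) => [<-|ne].
    rewrite take_incr mem_rcons inE => /orP[->|Ht]; first by right.
    by left; apply/begunP; exists j.
  by rewrite nth_incr_nth (negbTE ne) => Ht; left; apply/begunP; exists l.
- exists l => //; case: (eqVneq j l) => [e|ne].
    by rewrite -e take_incr mem_rcons inE e Ht orbT.
  by rewrite nth_incr_nth (negbTE ne).
- by exists j; rewrite // take_incr mem_rcons mem_head.
Qed.

Lemma bin_not_begun x (b : bin x) i : b \in bins x -> ~~ begun x i (plt b) ->
  exists2 l, l < n_queues x & b \in drop (nth 0 i l) (queue x l).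
Proof.
move=> /flattenP[q /(nthP [::])[l Hl <-] Hb] Ht; exists l => //.
move: Hb; rewrite -/(queue x l) -[X in _ \in X](cat_take_drop (nth 0 i l)) mem_cat.
case/orP=> // Hb; case/negP: Ht; apply/begunP; exists l => //.
by rewrite /labels -map_take map_f.
Qed.

(* Just before a pallet is opened, the configuration i is below the furthest one
   for the set s of pallets opened so far; so every pallet stuck there is open
   when the new pallet opens, and it comes on top of them. *)
Lemma stuck_lt_n_open x (s : seq nat) i j b0 :
  j < n_queues x -> nth 0 i j < size (queue x j) ->
  (forall l, nth 0 i l <= size (queue x l)) ->
  (forall t, begun x i t = (t \in s)) -> plt (nth b0 (queue x j) (nth 0 i j)) \notin s ->
  stuck (mem s) (items x) (pallets x) < n_open x (incr_nth i j).
Proof.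
move=> jk Hj Hi Hs; set b := nth b0 _ _ => bs.
have bq : b \in queue x j by rewrite mem_nth.
have bb : b \in bins x by apply/flattenP; exists (queue x j); rewrite ?mem_nth.
have bp : plt b \in pallets x by rewrite mem_undup map_f.
have drop_b : drop (nth 0 i j) (queue x j) = b :: drop (nth 0 i j).+1 (queue x j).
  exact: drop_nth.
have opened t : begun x i t ||(t == plt b) -> 
    exists2 l, l < n_queues x & t \in take (nth 0 (incr_nth i j) l) (labels x l).
  by rewrite -(begun_incr b0 t jk Hj) => /begunP.
pose a := fun u : nat => (u \in s) && behind (mem s) (items x) u.
(* The new pallet is outside [s], so this union is disjoint and has one element more than the stuck
   pallets; it remains to see that all its elements are open. *)
apply: (@leq_trans (count (predU (pred1 (plt b)) a) (pallets x))).
  have := count_predUI (pred1 (plt b)) a (pallets x).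
  rewrite (count_uniq_mem _ (undup_uniq _)) -/(pallets x) bp.
  rewrite [X in _ + X](eq_count (a2 := pred0)) ?count_pred0; last first.
    by move=> u /=; apply/negP => /andP[/eqP->]; rewrite /a (negbTE bs).
  by rewrite addn0 add1n /stuck /a => ->.
apply: sub_count => u /= /orP[/eqP->|/andP[us /behindP[l lk ul]]]; apply/is_openP.
  have [l lk Hl] := opened (plt b) (introT orP (or_intror (eqxx _))).
  (* The new pallet had not been begun in [i], so all its bins were still there, and the one other
     than [b] survives the step. *)
  have [b' b'b [eb ne]] := another_bin bb.
  have [|l' lk' Hl'] := bin_not_begun (i := i) b'b.
    by rewrite eb Hs.
  exists l, l'; split=> //; rewrite -eb /labels -map_drop map_f //.
  rewrite nth_incr_nth; case: (eqVneq j l') => [e|_] //.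
  by move: Hl'; rewrite -e drop_b inE (negbTE ne).
have [l' lk' Hl'] := opened u (introT orP (or_introl (etrans (Hs u) us))).
exists l', l; split=> //.
(* Only pallets in [s] have been begun, so [i] lies below the furthest configuration of [s]. *)
have below l0 : l0 < n_queues x -> nth 0 i l0 <= find (predC (mem s)) (labels x l0).
  move=> l0k; rewrite leqNgt; apply/negP => lt.
  have H : has (predC (mem s)) (take (nth 0 i l0) (labels x l0)).
    by rewrite has_take_leq // size_map.
  case/hasP: H => v Hv /= /negP[]; rewrite -[_ \in _]/(v \in s) -Hs.
  by apply/begunP; exists l0.
rewrite nth_incr_nth; case: (eqVneq j l) => [e|_]; last exact: mem_drop_leq (below _ lk) ul.
(* In queue [j] the step may pass the furthest position by one; the bin removed is then [b], which
   is not for [u], so the bin for [u] comes after it. *)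
move: ul; rewrite -e => ul; have /(_ jk) := below j; rewrite leq_eqVlt => /orP[/eqP e'|lt].
  move: ul; rewrite -e' -map_drop drop_b inE => /orP[/eqP eu|].
    by case/negP: bs; rewrite -eu.
  by rewrite /labels -map_drop.
exact: mem_drop_leq ul.
Qed.

(** [s] lists the begun pallets, the latest first. Only [behead s] is claimed to be good, because
    the pallets stuck for [s] itself are bounded only at the moment when the next pallet is
    opened. *)
Lemma processing_good x (cs : seq config) :
  path (step x) (start x) cs ->
  (forall c, c \in start x :: cs -> n_open x c <= places x) ->
  let i := last (start x) cs in
  [/\ size i = n_queues x, forall j, nth 0 i j <= size (queue x j) &
    exists s, [/\ uniq s, good (places x) (items x) (pallets x) (behead s),
      {subset s <= pallets x} & forall t, begun x i t = (t \in s)]].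
Proof.
elim/last_ind: cs => [_ _|cs c IH].
  split=> [|j|]; rewrite /= ?size_nseq ?nth_nseq ?if_same //.
  exists [::]; split=> //=.
    by rewrite stuck_nil places_gt0.
  by move=> t; apply/begunP => -[j jk]; rewrite nth_nseq jk take0.
rewrite rcons_path last_rcons => /andP[pcs st] Hcs /=.
have {IH} [|/=] := IH pcs; first by move=> c' Hc'; apply: Hcs; rewrite -rcons_cons mem_rcons inE Hc' orbT.
move: (last _ cs) st Hcs => i /existsP[j /andP[Hj /eqP->]] Hcs si Hi [s [us gs sub Hs]].
have b0 : bin x by case: (queue x j) Hj.
pose b := nth b0 (queue x j) (nth 0 i j).
have bp : plt b \in pallets x.
  by apply: (mem_pallets_label (ltn_ord j)); rewrite map_f // mem_nth.
have Hinc := begun_incr b0 _ (ltn_ord j) Hj.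
split=> [|l|]; first by rewrite size_incr_nth si ltn_ord.
  by rewrite nth_incr_nth; case: eqP => [<-|_] //=; rewrite add0n.
case: (boolP (plt b \in s)) => bs.
  exists s; split=> // t; rewrite Hinc Hs orb_idr // => /eqP->.
  exact: bs.
exists (plt b :: s); split=> /=; first by rewrite bs us.
- have lt : stuck (mem s) (items x) (pallets x) < places x.
    apply: leq_trans (stuck_lt_n_open (ltn_ord j) Hj Hi Hs bs) _.
    by apply: Hcs; rewrite -rcons_cons mem_rcons mem_head.
  by case: (s) gs lt => [|t s'] /= *; apply/andP.
- by move=> t; rewrite inE => /orP[/eqP->|/sub].
- by move=> t; rewrite Hinc Hs inE orbC.
Qed.

Lemma stack_up_good x :
  stack_up x <->
  exists s, [/\ uniq s, s =i pallets x & good (places x) (items x) (pallets x) s].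
Proof.
split=> [[cs [/andP[pcs /eqP lcs] Hcs]]|[s [us es gs]]].
  have [_ _ [s [us gs sub Hs]]] := processing_good pcs Hcs.
  have es : s =i pallets x.
    move=> t; rewrite -Hs lcs mem_pallets; apply: eq_in_has => j.
    rewrite mem_iota /= => jk; rewrite take_oversize //.
    by rewrite (nth_map [::]) // size_map.
  (* No later opening bounds the set of all pallets, but nothing is left in its furthest
     configuration. *)
  have s0 : stuck (mem s) (items x) (pallets x) < places x.
    by rewrite stuck_full ?places_gt0 // => t; rewrite -es.
  by exists s; split=> //; case: (s) gs s0 => [|t s'] /= *; apply/andP.
have [|cs [pcs lcs Hcs]] := good_processing us _ gs; first by move=> t; rewrite es.
exists cs; split=> //; rewrite /processing pcs lcs furthest_full //= => t.
by rewrite -es.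
Qed.

(** * Sets of pallets as bit masks *)

Definition bit (x t : nat) : bool := odd (x %/ 2 ^ t).

Lemma bit0 t : bit 0 t = false.
Proof. by rewrite /bit div0n. Qed.

Lemma modn_exp2S x t : x %% 2 ^ t.+1 = bit x t * 2 ^ t + x %% 2 ^ t.
Proof.
rewrite [in LHS](divn_eq x (2 ^ t)) /bit -[in LHS](odd_double_half (x %/ 2 ^ t)).
rewrite mulnDl -muln2 -mulnA -expnS addnAC -modnDmr modnMl addn0 modn_small //.
have := ltn_pmod x (expn_gt0 2 t); rewrite expnS; case: (odd _) => /=; lia.
Qed.

Lemma bit_leq_mod x t : bit x t = (2 ^ t <= x %% 2 ^ t.+1).
Proof.
rewrite modn_exp2S; have := ltn_pmod x (expn_gt0 2 t); case: (bit x t) => /=; lia.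
Qed.

Lemma bit_sub x t u : bit x t -> bit (x - 2 ^ t) u = bit x u && (u != t).
Proof.
move=> bt; pose y := x - 2 ^ t.
have lx : 2 ^ t <= x by apply: leq_trans (leq_mod x (2 ^ t.+1)); rewrite -bit_leq_mod.
have ex : x = y + 2 ^ t by rewrite subnK.
have dt : x %/ 2 ^ t = (y %/ 2 ^ t).+1 by rewrite ex divnDr // divnn expn_gt0 addn1.
have yt : ~~ bit y t by move: bt; rewrite /bit dt.
case: (ltngtP u t) => [ut|tu|->]; rewrite ?andbT ?andbF; last exact: negbTE.
  (* Below [t]: the quotients by [2 ^ u] differ by [2 ^ (t - u)], which is even. *)
  rewrite -/y /bit [in RHS]ex addnC -(subnK (ltnW ut)) expnD.
  by rewrite divnMDl ?expn_gt0 // oddD oddX subn_eq0 leqNgt ut.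
(* Above [t]: the quotient of [y] by [2 ^ t] is even and that of [x] is its successor, so both have
   the same half. *)
rewrite -/y /bit -(subnK tu) addnC expnD expnSr -mulnA !divnMA dt.
by move: yt; rewrite /bit => /negbTE yt; congr (odd (_ %/ _)); rewrite !divn2 /= uphalf_half yt.
Qed.

Lemma bit_full m t : t < m -> bit (2 ^ m).-1 t.
Proof.
move=> tm; rewrite bit_leq_mod -(subnK tm) expnD.
have a0 := expn_gt0 2 (m - t.+1); have d0 := expn_gt0 2 t.+1.
have -> : (2 ^ (m - t.+1) * 2 ^ t.+1).-1 = (2 ^ (m - t.+1)).-1 * 2 ^ t.+1 + (2 ^ t.+1).-1.
  by rewrite -!subn1 mulnBl mul1n addnBA // subnK // leq_pmull.
rewrite modnMDl modn_small; first by rewrite expnS; lia.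
by rewrite prednK.
Qed.

Lemma bit_exists m x : 0 < x < 2 ^ m -> exists2 t, t < m & bit x t.
Proof.
(* The witness is the highest bit set in [x]. *)
case/andP=> x0 xm; exists (trunc_log 2 x).
  by rewrite -(ltn_exp2l _ _ (ltnSn 1)); apply: leq_ltn_trans xm; apply: trunc_logP.
rewrite bit_leq_mod modn_small; first exact: trunc_logP.
exact: trunc_log_ltn.
Qed.

Definition setof (sym : seq nat) (mask : nat) : pred nat :=
  fun t => (t \in sym) && bit mask (index t sym).

Lemma in_setof sym mask t :
  (t \in setof sym mask) = (t \in sym) && bit mask (index t sym).
Proof. by []. Qed.

Definition reach p l (sym : seq nat) mask : Prop :=
  exists s, [/\ uniq s, s =i setof sym mask & good p l sym s].

(** The recurrence of the dynamic program. An admissible order of a nonempty set has a head, the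
    pallet opened last; its bit is cleared and the tail orders the smaller set. *)
Lemma reach_rec p l sym mask :
  uniq sym -> mask < 2 ^ size sym ->
  reach p l sym mask <->
  stuck (setof sym mask) l sym < p /\
  (mask = 0 \/ exists2 i, i < size sym & bit mask i /\ reach p l sym (mask - 2 ^ i)).
Proof.
move=> usym mlt; split=> [[s [us es gs]]|[lt H]].
  split; first by rewrite -(eq_stuck _ _ es); apply: good_stuck gs.
  case: (posnP mask) => [|m0]; [by left|right].
  case: s us es gs => [|t s] /= us es gs.
    have [|i im bi] := bit_exists (x := mask) (m := size sym); first by rewrite m0.
    have := es (nth 0 sym i); rewrite in_setof mem_nth // index_uniq //.
    by rewrite bi in_nil.
  have := es t; rewrite mem_head in_setof => /esym/andP[tsym bt].
  exists (index t sym); rewrite ?index_mem //; split=> //.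
  case/andP: us => ts us; exists s; split=> //; last by case/andP: gs.
  move=> u; rewrite in_setof bit_sub // andbA.
  have := es u; rewrite inE in_setof => <-.
  case: (eqVneq u t) => [->|ne] /=; first by rewrite eqxx (negbTE ts).
  case us': (u \in s) => //=; apply/esym/negP => /eqP e.
  have : u \in t :: s by rewrite inE us' orbT.
  rewrite es in_setof => /andP[usy _].
  by case/negP: ne; rewrite -(nth_index 0 usy) e nth_index.
case: H => [m0|[i im [bi [s [us es gs]]]]].
  exists [::]; split=> // [t|]; first by rewrite in_setof m0 bit0 andbF.
  rewrite /= andbT; apply: leq_ltn_trans lt; rewrite stuck_nil //.
exists (nth 0 sym i :: s).
have e : nth 0 sym i :: s =i setof sym mask.
  move=> u; rewrite inE es !in_setof bit_sub //.
  case: (eqVneq u (nth 0 sym i)) => [->|ne] /=.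
    by rewrite mem_nth // index_uniq.
  case usy: (u \in sym) => //=; rewrite [_ != _](_ : _ = true) ?andbT //.
  by apply: contra ne => /eqP <-; rewrite nth_index.
split=> //=.
  by rewrite us es in_setof bit_sub // index_uniq // eqxx !andbF.
by rewrite gs (eq_stuck _ _ e) lt.
Qed.

Lemma perm_good p l sym sym' s :
  perm_eq sym sym' -> good p l sym s = good p l sym' s.
Proof.
by move=> /permP es; elim: s => [|t s IH] /=; rewrite /stuck es ?IH.
Qed.

(** Any enumeration [sym] is allowed because the program numbers the pallets by first appearance,
    whereas [undup] in [pallets] keeps last occurrences. *)
Lemma stack_up_reach x sym :
  uniq sym -> sym =i pallets x ->
  stack_up x <-> reach (places x) (items x) sym (2 ^ size sym).-1.
Proof.
move=> usym esym.
have pe : perm_eq sym (pallets x) by apply: uniq_perm; rewrite ?undup_uniq.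
have full t : (t \in pallets x) = (t \in setof sym (2 ^ size sym).-1).
  by rewrite -esym in_setof; case: (boolP (t \in sym)) => //= H; rewrite bit_full ?index_mem.
apply: (iff_trans (stack_up_good x)).
split=> -[s [us es gs]]; exists s; split=> //.
- by move=> t; rewrite es full.
- by rewrite (perm_good _ _ _ pe).
- by move=> t; rewrite es full.
- by rewrite -(perm_good _ _ _ pe).
Qed.

(** * The program *)

(* Register 0 holds the end of the input, 1 the number p of places, 2 the number
   m of pallets, 4 and 17 the constants 1 and 0, 7 the current mask and 8 its
   bound 2^m.  The input is followed by the list of symbols, later overwritten by
   the powers of 2; then, from the addresses in registers 5 and 6 on, come the
   status words of the pallets and the table indexed by the masks. *)
Definition scan : prog :=
  PConst 9 0 ;; PMove 15 2 ;;
  PWhile (TLt 9 2)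
    (PAdd 12 0 9 ;; PLoad 12 12 ;;
     PIf (TEq 12 10) (PMove 15 9) PSkip ;;
     PAdd 9 9 4).

Lemma scan_runs s q :
  uniq q -> reg s 2 = size q -> reg s 4 = 1 ->
  (forall t, t < size q -> cell s (reg s 0 + t) = nth 0 q t) ->
  runs scan s (size q * 6 + 3)
    (fun s' => reg s' 15 = index (reg s 10) q /\ cell s' = cell s).
Proof.
move=> uq r2 r4 Hq; rewrite addn3 /scan; do 4!step.
set x := reg s 10; set s0 := set_reg _ _ _.
pose I t s' := [/\ reg s' 9 = t, cell s' = cell s &
  reg s' 15 = if x \in take t q then index x q else size q].
apply: (runs_tail (runs_while (n := size q) (T := 5) (I := I) _ _ _)).
- by split=> //=; rewrite take0 r2.
- by move=> t s' _ [/= -> _ _] /(_ 2 isT) /= ->; rewrite r2.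
- move=> t s' lt [r9 Hc r15] A.
  have /= a0 := A 0 isT; have /= a4 := A 4 isT; have /= a10 := A 10 isT.
  rewrite /I (take_nth 0 lt) mem_rcons inE.
  do !step; rewrite r9 Hc a0 a10 Hq // -/x => e; do !step; split; rewrite //= ?a4 ?r4 ?r9 ?addn1 //.
    by rewrite eq_sym e -(eqP e) index_uniq.
  by rewrite eq_sym (negbTE e) r15.
- by [].
- move=> s' [_ Hc ->] _; split=> //.
  by rewrite take_size; case: ifP => // /negbT/memNindex.
Qed.

(** Both reversals make [undup] keep first occurrences, so that reading one more word can only
    append a symbol and the numbers already assigned stay valid. *)
Definition symbols (w : seq nat) : seq nat := rev (undup (rev w)).

Lemma symbols_rcons w t :
  symbols (rcons w t) = if t \in symbols w then symbols w else rcons (symbols w) t.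
Proof.
rewrite /symbols rev_rcons /= [in RHS]mem_rev mem_undup; case: ifP => // _.
by rewrite rev_cons.
Qed.

Lemma symbols_uniq w : uniq (symbols w).
Proof. by rewrite rev_uniq undup_uniq. Qed.

Lemma mem_symbols w : symbols w =i w.
Proof. by move=> t; rewrite mem_rev mem_undup mem_rev. Qed.

Lemma size_symbols w : size (symbols w) = size (undup w).
Proof.
apply/perm_size/uniq_perm; rewrite ?symbols_uniq ?undup_uniq // => t.
by rewrite mem_symbols mem_undup.
Qed.

(* f i is the word that stands for the pallet of bin i: its symbol in the input,
   its number after the pallets have been renamed. *)
Definition stores (l : seq (nat * nat)) (f : nat -> nat) (s : state) : Prop :=
  forall i, i < size l ->
    cell s (3 + 2 * i) = (nth (0, 0) l i).1 /\ cell s (3 + 2 * i).+1 = f i.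

Definition label (l : seq (nat * nat)) (i : nat) : nat := (nth (0, 0) l i).2.

(** [scan] returns the length of the symbol list when the symbol is absent, so equality of registers
    15 and 2 means that it is new, and register 15 is the right number in both cases. *)
Definition rename : prog :=
  PConst 2 0 ;; PConst 3 3 ;;
  PWhile (TLt 3 0)
    (PAdd 11 3 4 ;; PLoad 10 11 ;;
     scan ;;
     PIf (TEq 15 2) (PAdd 12 0 2 ;; PStore 12 10 ;; PAdd 2 2 4) PSkip ;;
     PStore 11 15 ;; PAdd 3 11 4).

Lemma rename_runs s l :
  let sym := symbols (map snd l) in
  reg s 0 = 3 + 2 * size l -> reg s 4 = 1 -> stores l (label l) s ->
  runs rename s (size l * (6 * size l + 13) + 3)
    (fun s' => reg s' 2 = size sym /\ stores l (fun i => index (label l i) sym) s').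
Proof.
move=> sym r0 r4 Hl; rewrite addn3 /rename; do 4!step.
set s0 := set_reg _ _ _; set n := size l.
pose sy i := symbols (take i (map snd l)).
have usy i : uniq (sy i) := symbols_uniq _.
have sz_sy i : size (sy i) <= n.
  rewrite size_symbols (leq_trans (size_undup _)) // size_take_min size_map.
  exact: geq_minr.
have label_sy i : i < n -> sy i.+1 =
    if label l i \in sy i then sy i else rcons (sy i) (label l i).
  move=> lt; rewrite /sy (take_nth 0) ?size_map // symbols_rcons.
  by rewrite (nth_map (0, 0)).
have mem_sy i e : e < i <= n -> label l e \in sy i.
  move=> /andP[ei il]; rewrite mem_symbols /label -(nth_map _ 0) ?(leq_trans ei) //.
  rewrite -(nth_take 0 ei) mem_nth // size_take_min size_map.
  by rewrite leq_min ei (leq_trans ei).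
(* The words of the first [i] bins already hold numbers, the others still hold symbols. The symbol
   list starts at the end of the input, so the two stores of a round do not interfere. *)
pose I i s' := [/\ reg s' 3 = 3 + 2 * i, reg s' 2 = size (sy i),
  stores l (fun e => if e < i then index (label l e) (sy i) else label l e) s' &
  forall t, t < size (sy i) -> cell s' (reg s 0 + t) = nth 0 (sy i) t].
apply: (runs_tail (runs_while (n := n) (T := 6 * n + 12) (I := I) _ _ _)).
- have sy0 : sy 0 = [::] by rewrite /sy take0.
  by split; rewrite ?sy0 //= => t.
- move=> i s' _ [/= -> _ _ _] /(_ 0 isT) /= ->; rewrite r0; lia.
- move=> i s' lt [r3 r2 Hst Hsy] A.
  have /= a0 := A 0 isT; have /= a4 := A 4 isT.
  have -> : 6 * n + 12 = (6 * n + 10).+2 by lia.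
  do 4!step.
  have [_] := Hst i lt; rewrite ltnn => Hx.
  apply: (runs_call (T2 := 7) (scan_runs (usy i) _ _ _)); rewrite /= ?r2 ?a4 ?r4 //.
  + by rewrite a0.
  + by have := sz_sy i; lia.
  move=> s1 [/= b15 Hc] B.
  have /= b0 := B 0 isT; have /= b2 := B 2 isT; have /= b4 := B 4 isT.
  have /= b10 := B 10 isT; have /= b11 := B 11 isT; have /= b3 := B 3 isT.
  rewrite ?a4 ?r4 r3 addn1 ?Hx in b15 b10 b11.
  step; rewrite b15 b2 r2 => e; do !step.
    have new : label l i \notin sy i by rewrite -index_mem (eqP e) ltnn.
    have syS : sy i.+1 = rcons (sy i) (label l i).
      by rewrite label_sy // (negbTE new).
    rewrite /I syS size_rcons; split=> /=.
    + by rewrite b11 b4 a4 r4; lia.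
    + by rewrite b2 r2 b4 a4 r4 addn1.
    + move=> f fn; have [Hf1 Hf2] := Hst f fn.
      rewrite /= b11 b0 a0 b2 r2 r0 Hc Hf1 Hf2 b15 b10.
      have -> : (3 + 2 * f == (3 + 2 * i).+1) = false by lia.
      have -> : (3 + 2 * f == 3 + 2 * size l + size (sy i)) = false by lia.
      have -> : ((3 + 2 * f).+1 == 3 + 2 * size l + size (sy i)) = false.
        by rewrite -/n; lia.
      have -> : ((3 + 2 * f).+1 == (3 + 2 * i).+1) = (f == i) by lia.
      split=> //; rewrite -cats1 index_cat ltnS.
      case: (ltngtP f i) => [fi|fi|->] //; first by rewrite mem_sy ?fi // ltnW.
      by rewrite (negbTE new) (eqP e) /= eqxx addn0.
    + move=> t; rewrite ltnS b11 b0 a0 b2 r2 b10 Hc nth_rcons eqn_add2l => ht.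
      have -> : (reg s 0 + t == (3 + 2 * i).+1) = false by rewrite r0 -/n; lia.
      by case: ltngtP ht => // ht _; apply: Hsy.
  have old : label l i \in sy i by rewrite -index_mem ltn_neqAle e index_size.
  have syS : sy i.+1 = sy i by rewrite label_sy // old.
  rewrite /I syS; split=> /=.
  + by rewrite b11 b4 a4 r4; lia.
  + by rewrite b2 r2.
  + move=> f fn; have [Hf1 Hf2] := Hst f fn.
    rewrite /= b11 Hc Hf1 Hf2 b15.
    have -> : (3 + 2 * f == (3 + 2 * i).+1) = false by lia.
    have -> : ((3 + 2 * f).+1 == (3 + 2 * i).+1) = (f == i) by lia.
    by split=> //; rewrite ltnS; case: ltngtP => // ->.
  + move=> t ht; rewrite b11 Hc ifN ?Hsy // r0 -/n.
    by apply/eqP; lia.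
- by lia.
- move=> s' [_ r2 Hst _] _; split; first by rewrite r2 /sy take_oversize ?size_map.
  move=> i lt; have [-> ->] := Hst i lt; rewrite lt /sy take_oversize ?size_map //.
Qed.

(** * Powers of 2 and the bits of a mask *)

Definition powers : prog :=
  PConst 9 0 ;; PConst 8 1 ;;
  PWhile (TLt 9 2)
    (PAdd 12 0 9 ;; PStore 12 8 ;; PAdd 8 8 8 ;; PAdd 9 9 4).

Lemma powers_runs s :
  reg s 4 = 1 ->
  runs powers s (5 * reg s 2 + 3)
    (fun s' => [/\ reg s' 8 = 2 ^ reg s 2,
       forall t, t < reg s 2 -> cell s' (reg s 0 + t) = 2 ^ t &
       forall a, a < reg s 0 -> cell s' a = cell s a]).
Proof.
move=> r4; rewrite addn3 /powers; do 4!step.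
set s0 := set_reg _ _ _; set m := reg s 2.
pose I t s' := [/\ reg s' 9 = t, reg s' 8 = 2 ^ t,
  forall u, u < t -> cell s' (reg s 0 + u) = 2 ^ u &
  forall a, a < reg s 0 -> cell s' a = cell s a].
apply: (runs_tail (runs_while (n := m) (T := 4) (I := I) _ _ _)).
- by split.
- by move=> t s' _ [/= -> _ _ _] /(_ 2 isT) /= ->.
- move=> t s' lt [r9 r8 Hp Hlow] A.
  have /= a0 := A 0 isT; have /= a4 := A 4 isT.
  do !step; split; rewrite /= ?r9 ?r8 ?a4 ?r4 ?addn1 //.
  + by rewrite expnS mul2n -addnn.
  + move=> u; rewrite a0 eqn_add2l ltnS leq_eqVlt.
    by case: eqP => [-> //|_] /= /Hp.
  + by move=> a ha; rewrite a0 ifN ?Hlow //; apply/eqP; lia.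
- by rewrite mulnC.
- by move=> s' [].
Qed.

(** Bits are found from the top: the remainder in register 10 is compared with the current power of
    2, which is subtracted when it fits. *)
Definition decode : prog :=
  PMove 9 2 ;; PMove 10 7 ;;
  PWhile (TLt 17 9)
    (PSub 9 9 4 ;; PAdd 12 0 9 ;; PLoad 12 12 ;; PAdd 11 5 9 ;;
     PIf (TLt 10 12) (PStore 11 17) (PStore 11 4 ;; PSub 10 10 12)).

Lemma decode_runs s :
  let m := reg s 2 in
  reg s 4 = 1 -> reg s 17 = 0 -> reg s 5 = reg s 0 + m -> reg s 7 < 2 ^ m ->
  (forall t, t < m -> cell s (reg s 0 + t) = 2 ^ t) ->
  runs decode s (8 * m + 3)
    (fun s' => (forall t, t < m -> cell s' (reg s 5 + t) = bit (reg s 7) t) /\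
       forall a, (a < reg s 5) || (reg s 5 + m <= a) -> cell s' a = cell s a).
Proof.
move=> m r4 r17 r5 lt7 Hp; rewrite addn3 /decode; do 4!step.
set s0 := set_reg _ _ _.
(* After [j] rounds the [j] highest bits are written and the remainder is what the lower bits
   represent. *)
pose I j s' := [/\ reg s' 9 = m - j, reg s' 10 = reg s 7 %% 2 ^ (m - j),
  forall t, m - j <= t < m -> cell s' (reg s 5 + t) = bit (reg s 7) t &
  forall a, (a < reg s 5) || (reg s 5 + m <= a) -> cell s' a = cell s a].
apply: (runs_tail (runs_while (n := m) (T := 7) (I := I) _ _ _)).
- split; rewrite /= ?subn0 ?modn_small // => t; lia.
- by move=> j s' _ [/= -> _ _ _] /(_ 17 isT) /= ->; rewrite r17; lia.
- move=> j s' lt [r9 r10 Hb Hc] A.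
  have /= a0 := A 0 isT; have /= a4 := A 4 isT; have /= a5 := A 5 isT.
  have /= a17 := A 17 isT.
  have [ej em] : m - j = (m - j.+1).+1 /\ m - j.+1 < m by lia.
  have ec : cell s' (reg s 0 + (m - j.+1)) = 2 ^ (m - j.+1).
    by rewrite Hc ?Hp // r5; apply/orP; left; lia.
  have bitE := bit_leq_mod (reg s 7) (m - j.+1).
  have modE := modn_exp2S (reg s 7) (m - j.+1).
  rewrite ej in r9 r10 Hb.
  do 9!step; rewrite r9 r10 a0 a4 r4 a5 subn1 /= ec => h; do !step;
    split; rewrite /= ?r9 ?r10 ?a0 ?a4 ?a5 ?a17 ?r4 ?r17 ?subn1 //.
  + by rewrite modE bitE leqNgt h.
  + move=> t ht; rewrite eqn_add2l; case: eqP => [->|ne].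
      by rewrite bitE leqNgt h.
    by apply: Hb; lia.
  + by move=> a ha; rewrite ifN ?Hc //; apply/eqP; lia.
  + by rewrite modE bitE leqNgt h mul1n addKn.
  + move=> t ht; rewrite eqn_add2l; case: eqP => [->|ne].
      by rewrite bitE leqNgt h.
    by apply: Hb; lia.
  + by move=> a ha; rewrite ifN ?Hc //; apply/eqP; lia.
- by lia.
- move=> s' [_ _ Hb Hc] _; split=> // t ht; rewrite Hb // subnn //.
Qed.

(** * Counting the stuck pallets in one pass *)

Definition blocked (S : pred nat) (l : seq (nat * nat)) (q : nat) : bool :=
  has (fun y => ~~ S y.2 && (y.1 == q)) l.

(** This is why one pass is enough: a new item affects only its own pallet, and only through whether
    its queue is blocked already. *)
Lemma behind_rcons (S : pred nat) l z t :
  S t -> behind S (rcons l z) t = behind S l t || (z.2 == t) && blocked S l z.1.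
Proof.
move=> St; apply/hasP/orP => [[y _ /andP[Sy]]|[/hasP[y yl /andP[Sy M]]|]].
- rewrite -cats1 mem2_cat mem2_seq1 mem_seq1 => /orP[/orP[M|/andP[/eqP ey /eqP e]]|/andP[yl /eqP e]].
  + by left; apply/hasP; exists y; rewrite ?(mem2l M) // Sy.
  + by move: Sy; rewrite ey -e /= St.
  + by right; rewrite -e eqxx /=; apply/hasP; exists y; rewrite // Sy eqxx.
- exists y; first by rewrite mem_rcons inE yl orbT.
  by rewrite Sy -cats1 mem2_cat M.
- move=> /andP[/eqP e /hasP[y yl /andP[Sy /eqP ey]]].
  exists y; first by rewrite mem_rcons inE yl orbT.
  by rewrite Sy -cats1 mem2_cat yl ey -e -surjective_pairing mem_seq1 eqxx orbT.
Qed.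

Lemma blocked_rcons (S : pred nat) l z q :
  blocked S (rcons l z) q = ~~ S z.2 && (z.1 == q) || blocked S l q.
Proof. by rewrite /blocked has_rcons. Qed.

(* Register 13 holds the successor of the last queue found to be blocked, which
   suffices because the bins are sorted by queue.  The status word of a pallet is
   0 outside the set, 1 in the set, and 2 once the pallet has been counted. *)
Definition count_stuck : prog :=
  PConst 13 0 ;; PConst 14 0 ;; PConst 3 3 ;;
  PWhile (TLt 3 0)
    (PLoad 16 3 ;; PAdd 16 16 4 ;;
     PAdd 3 3 4 ;; PLoad 12 3 ;; PAdd 11 5 12 ;; PLoad 12 11 ;;
     PIf (TEq 12 17) (PMove 13 16)
       (PIf (TEq 13 16)
         (PIf (TEq 12 4) (PAdd 12 4 4 ;; PStore 11 12 ;; PAdd 14 14 4) PSkip)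
         PSkip) ;;
     PAdd 3 3 4).

Lemma count_stuck_runs s l sym mask :
  let m := size sym in
  let S := setof sym mask in
  uniq sym -> {subset map snd l <= sym} ->
  pairwise (fun y z : nat * nat => y.1 <= z.1) l ->
  reg s 0 = 3 + 2 * size l -> reg s 4 = 1 -> reg s 17 = 0 ->
  reg s 0 <= reg s 5 ->
  stores l (fun i => index (label l i) sym) s ->
  (forall t, t < m -> cell s (reg s 5 + t) = bit mask t) ->
  runs count_stuck s (14 * size l + 4)
    (fun s' => [/\ reg s' 14 = stuck S l sym,
       forall t, t < m -> (cell s' (reg s 5 + t) == 0) = ~~ bit mask t &
       forall a, (a < reg s 5) || (reg s 5 + m <= a) -> cell s' a = cell s a]).
Proof.
move=> m S usym lsym sorted_l r0 r4 r17 r5 Hst Hbit.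
rewrite addn4 /count_stuck; do 6!step.
set s0 := set_reg _ _ _; set n := size l.
(* The clause on register 13 is restricted to queues not below any seen so far: an earlier blocked
   queue has been forgotten, but by sortedness it does not come up again. Value 0 stands for no
   blocked queue. The successor of [behind] gives the status words 1 and 2. *)
pose I i s' := [/\ reg s' 3 = 3 + 2 * i,
  reg s' 14 = stuck S (take i l) sym,
  forall q, all (fun y => y.1 <= q) (take i l) ->
    (reg s' 13 == q.+1) = blocked S (take i l) q,
  forall t, t < m -> cell s' (reg s 5 + t) =
    if bit mask t then (behind S (take i l) (nth 0 sym t)).+1 else 0 &
  forall a, (a < reg s 5) || (reg s 5 + m <= a) -> cell s' a = cell s a].
apply: (runs_tail (runs_while (n := n) (T := 13) (I := I) _ _ _)).
- split; rewrite /= ?take0 //.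
    by rewrite /stuck (eq_count (a2 := pred0)) ?count_pred0 // => t; rewrite /= andbF.
- by move=> i s' _ [/= -> _ _ _ _] /(_ 0 isT) /= ->; rewrite r0; lia.
- move=> i s' lt [r3 r14 r13 Hm Hc] A.
  have /= a0 := A 0 isT; have /= a4 := A 4 isT; have /= a5 := A 5 isT.
  have /= a17 := A 17 isT.
  have [Hq Hid] := Hst i lt.
  have Hq' : cell s' (3 + 2 * i) = (nth (0, 0) l i).1.
    by rewrite Hc ?Hq //; apply/orP; left; lia.
  have Hid' : cell s' (3 + 2 * i).+1 = index (label l i) sym.
    by rewrite Hc ?Hid //; apply/orP; left; lia.
  have zsym : label l i \in sym.
    by apply: lsym; rewrite /label map_f ?mem_nth.
  have idm : index (label l i) sym < m by rewrite index_mem.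
  have Hz := Hm _ idm.
  rewrite nth_index // in Hz.
  have SE : S (label l i) = bit mask (index (label l i) sym).
    by rewrite /S /setof zsym.
  have Sbit t : t < m -> S (nth 0 sym t) = bit mask t.
    by move=> tm; rewrite /S /setof mem_nth // index_uniq.
  have etake : take i.+1 l = rcons (take i l) (nth (0, 0) l i) by rewrite (take_nth (0, 0)).
  set z := nth (0, 0) l i in Hq Hq' etake.
  have ez : label l i = z.2 by [].
  rewrite ez in zsym idm Hz SE Hid Hid'.
  have le_z : all (fun y => y.1 <= z.1) (take i l).
    have /(pairwiseP (0, 0)) H := sorted_l.
    apply/allP => y /(nthP (0, 0))[j]; rewrite size_take_min => hj <-.
    have ji : j < i by lia.
    by rewrite nth_take //; apply: H; rewrite ?inE // (ltn_trans ji).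
  have blkE := r13 _ le_z.
  do 12!step; rewrite r3 a4 r4 Hq' !addn1 Hid' a5 Hz.
  step.
  + rewrite a17 r17 -SE => Szero.
    have nS : ~~ S z.2 by case: (S z.2) Szero.
    have same t : S t -> behind S (take i.+1 l) t = behind S (take i l) t.
      move=> St; rewrite etake behind_rcons //; case: eqP => [e|_]; rewrite ?orbF //.
      by rewrite e St in nS.
    do !step; split; rewrite /= ?a4 ?r4 //; first by lia.
    + rewrite r14; apply: eq_count => t; case St: (S t) => //=.
      by rewrite same.
    + move=> q; rewrite etake all_rcons blocked_rcons nS eqSS => /andP[zq _].
      case: (ltngtP z.1 q) zq => // zq _; apply/esym/hasPn => y /(allP le_z) yz.
      by rewrite negb_and (ltn_eqF (leq_ltn_trans yz zq)) orbT.
    + by move=> t tm; rewrite Hm // -Sbit //; case St: (S _) => //; rewrite same.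
  rewrite a17 r17 -SE => Sone.
  have zS : S z.2 by case: (S z.2) Sone.
  rewrite zS in Hz *.
  have blkS q : all (fun y => y.1 <= q) (take i.+1 l) ->
      (reg s' 13 == q.+1) = blocked S (take i.+1 l) q.
    by rewrite etake all_rcons blocked_rcons zS => /andP[_ /r13].
  (* Shared by the two branches in which a bin for a pallet of the set changes nothing: its queue is
     not blocked, or its pallet has been counted. *)
  have unchanged : ~~ (blocked S (take i l) z.1 && ~~ behind S (take i l) z.2) ->
      forall t, S t -> behind S (take i.+1 l) t = behind S (take i l) t.
    move=> h t St; rewrite etake behind_rcons //.
    case: eqP => [<-|_]; rewrite ?orbF //=.
    by move: h; case: (behind _ _ _); case: (blocked _ _ _).
  step; last first.
  + rewrite blkE => nblk; do !step.
    have same := unchanged _; rewrite (negbTE nblk) in same.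
    have {}same := same isT.
    split; rewrite /= ?a4 ?r4 //; first by lia.
    + rewrite r14; apply: eq_count => t; case St: (S t) => //=.
      by rewrite same.
    + by move=> t tm; rewrite Hm // -Sbit //; case St: (S _) => //; rewrite same.
  rewrite blkE => blk; step; last first.
  + rewrite a4 r4 eqSS eqb0 negbK => seen; do !step.
    have same := unchanged _; rewrite seen andbF in same.
    have {}same := same isT.
    split; rewrite /= ?a4 ?r4 //; first by lia.
    + rewrite r14; apply: eq_count => t; case St: (S t) => //=.
      by rewrite same.
    + by move=> t tm; rewrite Hm // -Sbit //; case St: (S _) => //; rewrite same.
  rewrite a4 r4 eqSS eqb0 => unseen; do !step.
  have new t : S t -> behind S (take i.+1 l) t = (t == z.2) || behind S (take i l) t.
    by move=> St; rewrite etake behind_rcons // blk andbT orbC eq_sym.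
  split; rewrite /= ?a4 ?r4 //; first by lia.
  (* The pallet of [z] was not counted before, so it is disjoint from [a] and adds exactly 1. *)
  + pose a t := S t && behind S (take i l) t.
    have -> : stuck S (take i.+1 l) sym = count (predU (pred1 z.2) a) sym.
      apply: eq_count => t; rewrite /= /a; case St: (S t); first by rewrite new.
      by case: eqP => // e; rewrite e zS in St.
    have := count_predUI (pred1 z.2) a sym.
    rewrite (count_uniq_mem _ usym) zsym [in X in _ + X](eq_count (a2 := pred0)).
      by rewrite count_pred0 addn0 => ->; rewrite addnC r14.
    by move=> t /=; rewrite /a; case: eqP => // ->; rewrite (negbTE unseen) andbF.
  + move=> t tm; rewrite eqn_add2l Hm // -Sbit //; case St: (S _).
      rewrite new //; case: (eqVneq t (index z.2 sym)) => [->|ne].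
        by rewrite nth_index // eqxx.
      rewrite (_ : (nth 0 sym t == z.2) = false) //.
      by apply: contraNF ne => /eqP <-; rewrite index_uniq.
    case: eqP => // e; move: St; rewrite e nth_index // zS //.
  + move=> a ha; rewrite ifN ?Hc //; apply/eqP; lia.
- by lia.
- move=> s' [_ r14 _ Hm Hc] _; rewrite /n take_size in r14 Hm; split=> // t tm.
  by rewrite Hm //; case: (bit _ _).
Qed.

(** Membership is read off the status words left by [count_stuck], where both 1 and 2 mean a set
    bit; hence the comparison with zero. The initial 1 for mask 0 accounts for the empty order. *)
Definition lookup : prog :=
  PConst 15 0 ;; PIf (TEq 7 17) (PConst 15 1) PSkip ;; PConst 9 0 ;;
  PWhile (TLt 9 2)
    (PAdd 11 5 9 ;; PLoad 12 11 ;;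
     PIf (TEq 12 17) PSkip
       (PAdd 11 0 9 ;; PLoad 11 11 ;; PSub 11 7 11 ;; PAdd 11 6 11 ;;
        PLoad 12 11 ;; PIf (TEq 12 4) (PConst 15 1) PSkip) ;;
     PAdd 9 9 4).

Lemma lookup_runs s :
  let m := reg s 2 in let mask := reg s 7 in
  reg s 4 = 1 -> reg s 17 = 0 ->
  (forall t, t < m -> cell s (reg s 0 + t) = 2 ^ t) ->
  (forall t, t < m -> (cell s (reg s 5 + t) == 0) = ~~ bit mask t) ->
  runs lookup s (12 * m + 5)
    (fun s' => reg s' 15 = ((mask == 0) ||
       has (fun t => bit mask t && (cell s (reg s 6 + (mask - 2 ^ t)) == 1))
         (iota 0 m)) :> nat /\ cell s' = cell s).
Proof.
move=> m mask r4 r17 Hp Hb; have -> : 12 * m + 5 = (12 * m).+4.+1 by lia.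
rewrite /lookup.
set c := fun t : nat => bit mask t && _.
pose I t s' := [/\ reg s' 9 = t, cell s' = cell s &
  reg s' 15 = ((mask == 0) || has c (iota 0 t)) :> nat].
(* The branches of the initial test differ only in register 15, so the loop is treated once for
   both. *)
suff loop s0 : cell s0 = cell s ->
    reg s0 15 = (mask == 0) :> nat -> reg s0 9 = 0 ->
    agrees_off [:: 9; 15] s s0 ->
    runs (PWhile (TLt 9 2)
    (PAdd 11 5 9 ;; PLoad 12 11 ;;
     PIf (TEq 12 17) PSkip
       (PAdd 11 0 9 ;; PLoad 11 11 ;; PSub 11 7 11 ;; PAdd 11 6 11 ;;
        PLoad 12 11 ;; PIf (TEq 12 4) (PConst 15 1) PSkip) ;;
     PAdd 9 9 4)) s0 (12 * m).+1 (fun s' => reg s' 15 = ((mask == 0) || has c (iota 0 m)) :> nat /\ cell s' = cell s).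
  do 3!step; rewrite r17 -/mask => h.
    do 4!step; apply: loop; rewrite /= ?h //.
    by move=> r; rewrite !inE negb_or => /andP[h9 h15]; rewrite /= (negbTE h9) (negbTE h15).
  do 4!step; apply: loop; rewrite /= ?(negbTE h) //.
  by move=> r; rewrite !inE negb_or => /andP[h9 h15]; rewrite /= (negbTE h9) (negbTE h15).
move=> c0 r15 r9 A0.
apply: (runs_tail (runs_while (n := m) (T := 11) (I := I) _ _ _)).
- by split; rewrite // orbF.
- by move=> t s' _ [/= -> _ _] /(_ 2 isT) /= ->; rewrite (A0 2 isT).
- move=> t s' lt [{}r9 Hc {}r15] A.
  have /= := A 0 isT; rewrite (A0 0 isT) => a0.
  have /= := A 4 isT; rewrite (A0 4 isT) => a4.
  have /= := A 5 isT; rewrite (A0 5 isT) => a5.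
  have /= := A 6 isT; rewrite (A0 6 isT) => a6.
  have /= := A 7 isT; rewrite (A0 7 isT) -/mask => a7.
  have /= := A 17 isT; rewrite (A0 17 isT) => a17.
  have Hhas : has c (iota 0 t.+1) = c t || has c (iota 0 t).
    by rewrite -addn1 iotaD has_cat orbC /= add0n orbF.
  do 5!step; rewrite r9 a5 a17 r17 Hc Hb // => bt; do 2!step.
    by step; rewrite /I Hhas; split; rewrite /= ?a4 ?r4 ?r9 ?addn1 // /c (negbTE bt).
  do 14!step; rewrite r9 a0 a6 a7 Hc Hp // a4 r4 => ct; do !step;
    rewrite /I Hhas; split; rewrite /= ?a4 ?r4 ?r9 ?addn1 // /c.
    by rewrite (negPn bt) ct orbT.
  by rewrite (negPn bt) (negbTE ct) r15.
- by rewrite mulnC.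
- by move=> s' [].
Qed.

(** * The table indexed by the masks *)

Definition tabulate : prog :=
  PConst 7 0 ;;
  PWhile (TLt 7 8)
    (decode ;; count_stuck ;; lookup ;;
     PIf (TLt 14 1) PSkip (PConst 15 0) ;;
     PAdd 11 6 7 ;; PStore 11 15 ;; PAdd 7 7 4).

Lemma tabulate_runs s l sym :
  let m := size sym in
  uniq sym -> {subset map snd l <= sym} ->
  pairwise (fun y z : nat * nat => y.1 <= z.1) l ->
  reg s 0 = 3 + 2 * size l -> reg s 2 = m -> reg s 4 = 1 ->
  reg s 5 = reg s 0 + m -> reg s 6 = reg s 5 + m -> reg s 8 = 2 ^ m ->
  reg s 17 = 0 ->
  stores l (fun i => index (label l i) sym) s ->
  (forall t, t < m -> cell s (reg s 0 + t) = 2 ^ t) ->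
  runs tabulate s (2 ^ m * (20 * m + 14 * size l + 18) + 2)
    (fun s' => forall mask, mask < 2 ^ m ->
       exists b : bool, cell s' (reg s 6 + mask) = b /\
         (b <-> reach (reg s 1) l sym mask)).
Proof.
move=> m usym lsym sorted_l r0 r2 r4 r5 r6 r8 r17 Hst Hp.
rewrite addn2 /tabulate; do 2!step.
set s0 := set_reg _ _ _; set n := size l.
pose I i s' := [/\ reg s' 7 = i,
  forall a, a < reg s 5 -> cell s' a = cell s a &
  forall mask, mask < i -> exists b : bool, cell s' (reg s 6 + mask) = b /\
         (b <-> reach (reg s 1) l sym mask)].
apply: (runs_tail (runs_while (n := 2 ^ m) (T := 20 * m + 14 * n + 17) (I := I) _ _ _)).
- by split.
- by move=> i s' _ [/= -> _ _] /(_ 8 isT) /= ->; rewrite r8.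
- move=> i s' lt [r7 Hc Ht] A.
  have /= a0 := A 0 isT; have /= a2 := A 2 isT; have /= a4 := A 4 isT.
  have /= a5 := A 5 isT; have /= a6 := A 6 isT; have /= a17 := A 17 isT.
  have /= a1 := A 1 isT.
  apply: (runs_call (T2 := 12 * m + 14 * n + 14) (decode_runs _ _ _ _ _));
    rewrite ?a0 ?a2 ?r2 ?a4 ?a5 ?a17 ?r7 //.
    by move=> t tm; rewrite Hc ?Hp // r5; lia.
    by lia.
  move=> s1 [Hb1 Hc1] A1.
  have := A1 0 isT; have := A1 1 isT; have := A1 2 isT; have := A1 4 isT; have := A1 5 isT.
  have := A1 6 isT; have := A1 7 isT; have := A1 17 isT.
  rewrite a0 a1 a2 a4 a5 a6 a17 r7 => b17 b7 b6 b5 b4 b2 b1 b0.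
  apply: (runs_call (T2 := 12 * m + 10) (count_stuck_runs (l := l) (sym := sym) (mask := i) _ _ _ _ _ _ _ _ _)) => //;
    rewrite ?b0 ?b4 ?b5 ?b17 //.
  + by rewrite r5; lia.
  + move=> f fn; have [h1 h2] := Hst f fn.
    have low a : a < 3 + 2 * n -> cell s1 a = cell s a.
      rewrite -r0 => h; have h5 : a < reg s 5 by rewrite r5; lia.
      by rewrite Hc1 ?Hc // ?a5 h5.
    by rewrite !low ?h1 ?h2 //; rewrite -/n in fn; lia.
  + by rewrite -/n; lia.
  move=> s2 [c14 Hb2 Hc2] A2.
  have := A2 0 isT; have := A2 1 isT; have := A2 2 isT; have := A2 4 isT; have := A2 5 isT.
  have := A2 6 isT; have := A2 7 isT; have := A2 17 isT.
  rewrite b0 b1 b2 b4 b5 b6 b7 b17 => c17 c7 c6 c5 c4 c2 c1 c0.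
  apply: (runs_call (T2 := 5) (lookup_runs _ _ _ _)); rewrite ?c0 ?c2 ?c4 ?c5 ?c7 ?c17 ?r2 //.
  + move=> t tm; have h5 : reg s 0 + t < reg s 5 by rewrite r5; lia.
    by rewrite Hc2 ?Hc1 ?Hc ?Hp ?h5.
  + by lia.
  move=> s3 [d15 Hc3] A3.
  have := A3 1 isT; have := A3 4 isT; have := A3 6 isT; have := A3 7 isT.
  have := A3 14 isT; rewrite c1 c4 c6 c7 c14 => e14 e7 e6 e4 e1.
  have keep a : (a < reg s 5) || (reg s 6 <= a) -> cell s3 a = cell s' a.
    by rewrite r6 => ha; rewrite Hc3 Hc2 ?Hc1.
  set ok := (_ || _) in d15.
  have okP : ok <-> i = 0 \/ exists2 t, t < m & bit i t /\ reach (reg s 1) l sym (i - 2 ^ t).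
    have tab t : bit i t -> cell s2 (reg s2 6 + (i - 2 ^ t)) = 1 <->
        reach (reg s 1) l sym (i - 2 ^ t).
      (* Clearing a set bit gives a smaller mask, whose entry is already in the table since masks
         are treated in increasing order. *)
      move=> bt; have lti : i - 2 ^ t < i.
        have : 2 ^ t <= i by apply: leq_trans (leq_mod i (2 ^ t.+1)); rewrite -bit_leq_mod.
        by have := expn_gt0 2 t; rewrite /=; lia.
      have [b [eb bP]] := Ht _ lti; rewrite -Hc3 c6 keep ?leq_addr ?orbT // eb -bP.
      by case: (b).
    rewrite /ok; split.
      case/orP=> [/eqP|/hasP[t]]; first by left.
      rewrite mem_iota => /= tm /andP[bt /eqP e]; right; exists t => //.
      by split=> //; apply/tab.
    case=> [->|[t tm [bt rt]]]; apply/orP; first by left.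
    right; apply/hasP; exists t; first by rewrite mem_iota.
    by rewrite bt /=; apply/eqP/tab.
  (* Both outcomes of the comparison with [p] store the conjunction required by [reach_rec], so one
     argument closes the round. *)
  have fin s4 : reg s4 7 = i.+1 -> (forall a, cell s4 a = if a == reg s 6 + i
      then (stuck (setof sym i) l sym < reg s 1) && ok : nat else cell s3 a) -> I i.+1 s4.
    move=> f7 fc; split=> // [a ha|mask].
      by rewrite fc ifN ?keep ?ha ?Hc //; apply/eqP; rewrite r6; lia.
    rewrite ltnS leq_eqVlt fc eqn_add2l; case: eqP => [-> _|_ /= /Ht].
      exists ((stuck (setof sym i) l sym < reg s 1) && ok); split=> //.
      by rewrite reach_rec // -okP; split=> [/andP[]|[-> ->]].
    by rewrite keep ?leq_addr ?orbT.
  step; rewrite e14 e1 => h; do !step; apply: fin => //=; rewrite ?e7 ?e6 ?e4 ?r4 ?addn1 // => a;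
    rewrite ?d15 ?h ?(negbTE h) //.
- by lia.
- by move=> s' [].
Qed.

(** The constant 1 in register 4 is also the address of [p]. Register 0 initially holds the length
    of the input, which is the address following it. The answer is the entry of the full mask,
    [2 ^ m - 1]. *)
Definition solver : prog :=
  PConst 4 1 ;; PLoad 1 4 ;; rename ;; powers ;; PAdd 5 0 2 ;; PAdd 6 5 2 ;;
  tabulate ;; PAdd 11 6 8 ;; PSub 11 11 4 ;; PLoad 0 11.

Lemma nth_flatten_pairs (l : seq (nat * nat)) i : i < size l ->
  let w := flatten [seq [:: y.1; y.2] | y <- l] in
  nth 0 w (2 * i) = (nth (0, 0) l i).1 /\ nth 0 w (2 * i).+1 = (nth (0, 0) l i).2.
Proof.
elim: l i => // y l IH [|i] lt; first by rewrite muln0.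
by have [h1 h2] := IH i lt; rewrite mulnS.
Qed.

Lemma size_flatten_pairs (l : seq (nat * nat)) :
  size (flatten [seq [:: y.1; y.2] | y <- l]) = 2 * size l.
Proof. by elim: l => //= y l ->; rewrite mulnS. Qed.

Lemma solver_runs x :
  let n := n_bins x in let m := n_pallets x in
  runs solver (init_state (encode x))
    (n * (6 * n + 13) + 5 * m + 2 ^ m * (20 * m + 14 * n + 18) + 15)
    (fun s => exists b : bool, output s = b /\ (b <-> stack_up x)).
Proof.
move=> n m; set T := (X in runs _ _ X).
set l := items x; pose sym := symbols (map snd l).
have sl : size l = n by apply: size_items.
have usym : uniq sym by apply: symbols_uniq.
have esym : sym =i pallets x by move=> t; rewrite mem_symbols items_labels mem_undup.
have sm : size sym = m by apply/perm_size/uniq_perm; rewrite // undup_uniq.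
have -> : T = (n * (6 * n + 13) + 5 * m + 2 ^ m * (20 * m + 14 * n + 18) + 13).+2.
  by rewrite /T; lia.
rewrite /solver; do 4!step.
have i0 : size (encode x) = 3 + 2 * size l by rewrite encode_items /= size_flatten_pairs.
apply: (runs_call (T2 := 5 * m + 2 ^ m * (20 * m + 14 * n + 18) + 10) (rename_runs (l := l) _ _ _)) => //=.
- move=> i lt; rewrite encode_items /=; exact: nth_flatten_pairs.
- by rewrite sl; lia.
move=> s1 [b2 Hst] B.
have /= b0 := B 0 isT; have /= b1 := B 1 isT; have /= b4 := B 4 isT; have /= b17 := B 17 isT.
have {}b0 : reg s1 0 = 3 + 2 * size l by rewrite b0 -i0.
apply: (runs_call (T2 := 2 ^ m * (20 * m + 14 * n + 18) + 7) (powers_runs _)) => //.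
  by rewrite b2 sm; lia.
rewrite b2 sm => s2 [c8 Hp Hlow] C.
have := C 0 isT; have := C 1 isT; have := C 2 isT; have := C 4 isT; have := C 17 isT.
rewrite b0 b1 b2 b4 b17 => c17 c4 c2 c1 c0.
have -> : 2 ^ m * (20 * m + 14 * n + 18) + 7 = (2 ^ m * (20 * m + 14 * n + 18) + 5).+2 by lia.
do 4!step.
apply: (runs_call (T2 := 3) (tabulate_runs (l := l) (sym := sym) _ _ _ _ _ _ _ _ _ _ _ _));
  rewrite /= ?c0 ?c2 ?c4 ?c8 ?c17 ?sm //.
- by move=> t; rewrite mem_symbols.
- exact: items_sorted.
- move=> i lt; have [h1 h2] := Hst i lt.
  have [l1 l2] : 3 + 2 * i < reg s1 0 /\ (3 + 2 * i).+1 < reg s1 0 by rewrite b0; lia.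
  by rewrite /= !Hlow.
- by move=> t; rewrite -b0; apply: Hp.
- by rewrite sl; lia.
move=> s3 Ht D.
have /= d4 := D 4 isT; have /= d6 := D 6 isT; have /= d8 := D 8 isT.
have [|b [eb bP]] := Ht (2 ^ m).-1; first by rewrite prednK ?expn_gt0.
do !step; exists b; split; last first.
  rewrite bP c1; apply: iff_sym; rewrite -sm; exact: stack_up_reach.
rewrite /output /= d6 d8 d4 -eb; congr cell.
by rewrite c8 c4 -subn1 addnBA ?expn_gt0.
Qed.

(** * Running time bounds *)

Lemma n_pallets_leq x : n_pallets x <= n_bins x.
Proof. by rewrite (leq_trans (size_undup _)) // size_map. Qed.

Lemma solver_decides :
  decides_within encode stack_up solver
    (fun x => 100 * (n_bins x ^ 2 * 2 ^ n_pallets x).+1).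
Proof.
move=> x; have [t [s [E Ht [b [eb bP]]]]] := solver_runs x.
exists t, s, b; split=> //; apply: leq_trans Ht _.
have := n_pallets_leq x; rewrite -mulnn.
(* Lower-order terms are absorbed by [n ^ 2] only when there is a bin; without bins the successor in
   the bound pays for the constants. *)
move: (n_bins x) (n_pallets x) => n m; case: (posnP n) => [->|n0 mn].
  by rewrite leqn0 => /eqP->.
have := expn_gt0 2 m; rewrite /=; move: (2 ^ m) => K K0.
(* 52 = 20 + 14 + 18, by [m <= n] and [1 <= n]. The remaining terms contribute at most 6 + 13 + 5
   times [n * n], plus 15, so 100 is ample. *)
have h : 20 * m + 14 * n + 18 <= 52 * (n * n) by nia.
have := leq_mul (leqnn K) h; nia.
Qed.

(** The factor 2 makes up for small [m], such as [m = 1]; from there on each step multiplies the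
    left side by 2 and the right side by at least 2. *)
Lemma leq_exp2_fact m : 2 ^ m <= 2 * m`!.
Proof.
elim: m => // -[|m] // IH; rewrite expnS factS mulnCA.
by apply: leq_mul.
Qed.

Lemma decides_within_weaken I enc (P : I -> Prop) c (T T' : I -> nat) :
  (forall x, T x <= T' x) -> decides_within enc P c T -> decides_within enc P c T'.
Proof.
move=> TT H x; have [t [s [b [E Ht eb bP]]]] := H x.
by exists t, s, b; split=> //; apply: leq_trans (TT x).
Qed.

Lemma computable_mul_exp2 c : computable (fun k => c * 2 ^ k).
Proof.
exists (PLoad 1 1 ;; PConst 4 1 ;; PConst 0 c ;;
  PWhile (TLt 2 1) (PAdd 0 0 0 ;; PAdd 2 2 4)) => k.
suff [t [s [E _ e]]] : runs (PLoad 1 1 ;; PConst 4 1 ;; PConst 0 c ;;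
  PWhile (TLt 2 1) (PAdd 0 0 0 ;; PAdd 2 2 4)) (init_state [:: k])
  (k * 3).+4 (fun s => reg s 0 = c * 2 ^ k).
  by exists t, s.
do 6!step; set s0 := set_reg _ _ _.
pose I i s' := reg s' 2 = i /\ reg s' 0 = c * 2 ^ i.
apply: (runs_tail (runs_while (n := k) (T := 2) (I := I) _ _ _)).
- by rewrite /I /= muln1.
- by move=> i s' _ [/= -> _] /(_ 1 isT) /= ->.
- move=> i s' _ [r2 r0] A; have /= a4 := A 4 isT.
  do !step; split; rewrite /= ?r2 ?a4 ?addn1 //.
  by rewrite r0 expnS addnn -muln2; lia.
- by [].
- by move=> s' [].
Qed.

(** Every word, even 0, is charged at least one bit. *)
Lemma leq_bit_size x : 3 + 2 * n_bins x <= bit_size (encode x).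
Proof.
rewrite /bit_size -(size_items x).
have -> : 3 + 2 * size (items x) = \sum_(a <- encode x) 1.
  by rewrite sum1_size encode_items /= size_flatten_pairs.
by apply: leq_sum.
Qed.

Theorem theorem15 :
  solvable_in_time_O encode stack_up
    (fun x : instance => n_bins x ^ 2 * (n_pallets x)`!) /\
  fixed_parameter_tractable encode stack_up n_pallets.
Proof.
split.
  (* 200 is the constant 100 of the solver times the factor lost in passing from the power of 2 to
     the factorial. *)
  exists solver, 200; apply: decides_within_weaken solver_decides => x.
  have := leq_mul (leqnn (n_bins x ^ 2)) (leq_exp2_fact (n_pallets x)).
  by rewrite mulnCA; lia.
(* The power of 2 is kept as the parameter function, and the square of the bit size dominates
   [n ^ 2 + 1]. *)
exists solver, (fun k => 100 * 2 ^ k), 2; split; first exact: computable_mul_exp2.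
apply: decides_within_weaken solver_decides => x.
rewrite -mulnA leq_pmul2l //.
have := leq_bit_size x; have := expn_gt0 2 (n_pallets x).
rewrite -!mulnn /=; move: (2 ^ _) (bit_size _) (n_bins x) => K b n K0 hb.
have h : (n * n).+1 <= b * b by apply: leq_trans (leq_mul hb hb); nia.
by apply: leq_trans (leq_mul (leqnn K) h); rewrite mulnS; lia.
Qed.
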